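(* Let $(\sigma,V^{(1)},V^{(2)})$ be a pure isometric covariant representation of the product system $\mathbb E$ over $\mathbb N_0^2$ on a Hilbert space $\mathcal H$, and let $(\rho,M_{\Theta_1},M_{\Theta_2})$ be its BCL-representation on $\mathcal F(E)\otimes\mathcal W$. Let $(\rho,S)$ be the induced representation of $E$ induced by $\sigma|_{\mathcal W}$. Then, with respect to the decompositions $E_1\otimes\mathcal W=E_1\otimes\widetilde V^{(2)}(E_2\otimes\mathcal W_1)\oplus E_1\otimes\mathcal W_2$ and $E_2\otimes\mathcal W=E_2\otimes\widetilde V^{(1)}(E_1\otimes\mathcal W_2)\oplus E_2\otimes\mathcal W_1$, $$\widetilde\Theta_1=\widetilde S\big(I_{E_1}\otimes\widetilde V^{(2)*}|_{\widetilde V^{(2)}(E_2\otimes\mathcal W_1)}\big)\oplus\widetilde V^{(1)}|_{E_1\otimes\mathcal W_2}$$ and $$\widetilde\Theta_2=\widetilde S(t_{2,1}\otimes I_{\mathcal W})\big(I_{E_2}\otimes\widetilde V^{(1)*}|_{\widetilde V^{(1)}(E_1\otimes\mathcal W_2)}\big)\oplus\widetilde V^{(2)}|_{E_2\otimes\mathcal W_1}.$$ (Here $A\oplus B$ denotes the operator equal to $A$ on the first summand of the domain and to $B$ on the second.)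
   Context: All $*$-homomorphisms and representations are nondegenerate. A $C^*$-correspondence over a $C^*$-algebra $\mathcal A$ is a Hilbert $\mathcal A$-module $F$ with a left action of $\mathcal A$ given by a $*$-homomorphism into the adjointable operators on $F$. Tensor products are interior tensor products, $F^{\otimes 0}=\mathcal A$, and for a representation $\sigma$ of $\mathcal A$ on a Hilbert space $\mathcal H$, $F\otimes\mathcal H=F\otimes_\sigma\mathcal H$ has inner product $\langle\xi_1\otimes h_1,\xi_2\otimes h_2\rangle=\langle h_1,\sigma(\langle\xi_1,\xi_2\rangle)h_2\rangle$; $\mathcal A\otimes\mathcal H$ is identified with $\mathcal H$. A (completely bounded) covariant representation of $F$ on $\mathcal H$ is a pair $(\sigma,V)$ with $\sigma:\mathcal A\to B(\mathcal H)$ a representation and $V:F\to B(\mathcal H)$ linear, completely bounded, with $V(b\xi a)=\sigma(b)V(\xi)\sigma(a)$. Put $\widetilde V:F\otimes\mathcal H\to\mathcal H$, $\widetilde V(\xi\otimes h)=V(\xi)h$, and $\widetilde V_n(\xi_1\otimes\cdots\otimes\xi_n\otimes h)=V(\xi_1)\cdots V(\xi_n)h$ on $F^{\otimes n}\otimes\mathcal H$ ($\widetilde V_0=I$). It is isometric if $V(\eta)^*V(\xi)=\sigma(\langle\eta,\xi\rangle)$ (equivalently $\widetilde V$ is an isometry), and pure if $\widetilde V_n\widetilde V_n^*\to0$ strongly. The Fock space is $\mathcal F(F)=\bigoplus_{n\ge0}F^{\otimes n}$ with the natural left action $\phi_\infty$. For a representation $\pi$ of $\mathcal A$ on $\mathcal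 K$, the induced representation $(\rho,S)$ of $F$ on $\mathcal F(F)\otimes_\pi\mathcal K$ is $\rho(a)=\phi_\infty(a)\otimes I$, $S(\xi)(\eta\otimes k)=(\xi\otimes\eta)\otimes k$. $\mathcal K$ is identified with the $n=0$ summand of $\mathcal F(F)\otimes\mathcal K$. If $(\sigma,V)$ is pure isometric with $\mathcal W=\mathcal H\ominus\widetilde V(F\otimes\mathcal H)$, then $\mathcal H=\bigoplus_n\widetilde V_n(F^{\otimes n}\otimes\mathcal W)$, and the Wold–von Neumann decomposition is the unitary $\Pi_V:\mathcal H\to\mathcal F(F)\otimes\mathcal W$, $\Pi_V\widetilde V_n(\eta_n\otimes w)=\eta_n\otimes w$; it intertwines $(\sigma,V)$ with the representation $(\rho,S)$ induced by $\sigma|_{\mathcal W}$. A product system $\mathbb E$ over $\mathbb N_0^2$ consists of $C^*$-correspondences $E_1,E_2$ over $\mathcal A$ and a unitary isomorphism $t_{2,1}:E_2\otimes E_1\to E_1\otimes E_2$; $t_{1,2}=t_{2,1}^{-1}$, $E:=E_1\otimes E_2$. A covariant representation of $\mathbb E$ on $\mathcal H$ is a triple $(\sigma,V^{(1)},V^{(2)})$ where each $(\sigma,V^{(i)})$ is a covariant representation of $E_i$ and $\widetilde V^{(1)}(I_{E_1}\otimes\widetilde V^{(2)})=\widetilde V^{(2)}(I_{E_2}\otimes\widetilde V^{(1)})(t_{1,2}\otimes I_{\mathcal H})$; it is isometric if both $(\sigma,V^{(i)})$ are. Then $\widetilde V:=\widetilde V^{(1)}(I_{E_1}\otimes\widetilde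 V^{(2)})$ defines an isometric covariant representation $(\sigma,V)$ of $E$, and the triple is called pure if $(\sigma,V)$ is pure. Put $\mathcal W=\mathcal H\ominus\widetilde V(E\otimes\mathcal H)$ and $\mathcal W_i=\mathcal H\ominus\widetilde V^{(i)}(E_i\otimes\mathcal H)$ (all $\sigma$-invariant); one has $\mathcal W=\mathcal W_1\oplus\widetilde V^{(1)}(E_1\otimes\mathcal W_2)=\widetilde V^{(2)}(E_2\otimes\mathcal W_1)\oplus\mathcal W_2$. BCL-representation: for a pure isometric triple, it is $(\rho,M_{\Theta_1},M_{\Theta_2})$ on $\mathcal F(E)\otimes\mathcal W$, where $\rho(a)=\phi_\infty(a)\otimes I_{\mathcal W}$, $M_{\Theta_i}(\xi_i)=\Pi_VV^{(i)}(\xi_i)\Pi_V^*$ for $\xi_i\in E_i$, $\Theta_i:E_i\to B(\mathcal W,\mathcal F(E)\otimes\mathcal W)$ is $\Theta_i(\xi_i)=M_{\Theta_i}(\xi_i)|_{\mathcal W}$, and $\widetilde\Theta_i:E_i\otimes\mathcal W\to\mathcal F(E)\otimes\mathcal W$ is $\widetilde\Theta_i(\xi\otimes w)=\Theta_i(\xi)w$. *)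

(* Defs.v *)
From HB Require Import structures.
From mathcomp Require Import all_boot all_order all_algebra.
From mathcomp Require Import boolp classical_sets reals topology normedtype.
From mathcomp Require Import sequences.
From mathcomp.real_closed Require Import complex.

Set Implicit Arguments.
Unset Strict Implicit.
Unset Printing Implicit Defensive.

Import Order.TTheory GRing.Theory Num.Theory ComplexField Normc.
Import numFieldNormedType.Exports.

Local Open Scope classical_set_scope.
Local Open Scope ring_scope.
Local Open Scope complex_scope.

Definition complete_for (R : realType) (V : lmodType R[i]) (N : V -> R) : Prop :=
  forall u : nat -> V,
    (forall e : R, 0 < e -> exists n0, forall m n, (n0 <= m)%N -> (n0 <= n)%N ->
       N (u m - u n) < e) ->
    exists l : V, N (u n - l) @[n --> \oo] --> (0 : R).

(* C*-algebras, not necessarily unital. *)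
Record cstar (R : realType) := Cstar {
  csort :> lmodType R[i];
  cmul : csort -> csort -> csort;
  cstr : csort -> csort;
  cnrm : csort -> R;
  cmulA : forall a b c, cmul a (cmul b c) = cmul (cmul a b) c;
  cmul_linl : forall b, linear (fun a => cmul a b);
  cmul_linr : forall a, linear (cmul a);
  cstrD : forall a b, cstr (a + b) = cstr a + cstr b;
  cstrZ : forall (z : R[i]) a, cstr (z *: a) = conjc z *: cstr a;
  cstrM : forall a b, cstr (cmul a b) = cmul (cstr b) (cstr a);
  cstrK : forall a, cstr (cstr a) = a;
  cnrm_eq0 : forall a, cnrm a = 0 -> a = 0;
  cnrmD : forall a b, cnrm (a + b) <= cnrm a + cnrm b;
  cnrmZ : forall (z : R[i]) a, cnrm (z *: a) = normc z * cnrm a;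
  cnrmM : forall a b, cnrm (cmul a b) <= cnrm a * cnrm b;
  cnrm_star : forall a, cnrm (cmul (cstr a) a) = cnrm a ^+ 2;
  ccomplete : complete_for cnrm }.

(* Right Hilbert B-modules; the inner product is linear in its second variable. *)
Record hmod (R : realType) (B : cstar R) := Hmod {
  hsort :> lmodType R[i];
  ract : hsort -> B -> hsort;
  ip : hsort -> hsort -> B;
  ract_linl : forall b, linear (fun x => ract x b);
  ract_linr : forall x, linear (ract x);
  ractM : forall x b c, ract x (cmul b c) = ract (ract x b) c;
  ip_linr : forall x, linear (ip x);
  ip_ract : forall x y b, ip x (ract y b) = cmul (ip x y) b;
  ip_star : forall x y, cstr (ip x y) = ip y x;
  ip_ge0 : forall x, exists b, ip x x = cmul (cstr b) b;
  ip_eq0 : forall x, ip x x = 0 -> x = 0;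
  hcomplete : complete_for (fun x : hsort => Num.sqrt (cnrm (ip x x))) }.

Definition hnrm (R : realType) (B : cstar R) (F : hmod B) (x : F) : R :=
  Num.sqrt (cnrm (ip x x)).

(* C*-correspondences from A to B: Hilbert B-modules with a left action of A by
   a *-homomorphism into the adjointable operators.  Such a homomorphism is
   automatically contractive; [lact_nrm] only records this.  Nondegeneracy is
   the separate predicate [nondegenerate]. *)
Record corr (R : realType) (A B : cstar R) := Corr {
  chmod :> hmod B;
  lact : A -> chmod -> chmod;
  lact_linl : forall x, linear (fun a => lact a x);
  lact_linr : forall a, linear (lact a);
  lactM : forall a b x, lact (cmul a b) x = lact a (lact b x);
  lact_adj : forall a x y, ip (lact a x) y = ip x (lact (cstr a) y);
  lact_ract : forall a x b, lact a (ract x b) = ract (lact a x) b;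
  lact_nrm : forall a x, hnrm (lact a x) <= cnrm a * hnrm x }.

Definition nondegenerate (R : realType) (A B : cstar R) (F : corr A B) : Prop :=
  forall (x : F) (e : R), 0 < e ->
  exists s : seq (A * F), hnrm (x - \sum_(p <- s) lact p.1 p.2) < e.

Section ComplexNumbers.
Variable R : realType.
Implicit Types z : R[i].

Lemma real_complete (v : nat -> R) :
  (forall e : R, 0 < e -> exists n0, forall m n, (n0 <= m)%N -> (n0 <= n)%N ->
     `|v m - v n| < e) -> exists l, `|v n - l| @[n --> \oo] --> (0 : R).
Proof.
move=> vC; have /cauchy_cvgP/cvg_ex[l vl] : cauchy (v @ \oo).
  apply: cauchy_exP => e e0; have [n0 vn0] := vC _ e0.
  exists (v n0); exists n0 => // n /= n0n; rewrite -ball_normE /=.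
  exact: vn0.
exists l; rewrite -(normr0 R); apply: cvg_norm.
by rewrite -(subrr l); apply: cvgB => //; exact: cvg_cst.
Qed.

Lemma normc_ge_ReIm z : `|complex.Re z| <= normc z /\ `|complex.Im z| <= normc z.
Proof.
case: z => a b /=; split; rewrite -sqrtr_sqr ler_wsqrtr //.
  by rewrite lerDl sqr_ge0.
by rewrite lerDr sqr_ge0.
Qed.

Lemma normc_le_ReIm z : normc z <= `|complex.Re z| + `|complex.Im z|.
Proof.
case: z => a b /=; rewrite -[leRHS]ger0_norm ?addr_ge0 // -sqrtr_sqr.
rewrite ler_wsqrtr // sqrrD !real_normK ?num_real // -addrA lerD2l lerDr.
by rewrite mulrn_wge0 // mulr_ge0.
Qed.

Lemma complex_complete : complete_for (V := R[i]^o) (@normc R).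
Proof.
move=> u uC.
have [a ua] : exists l, `|complex.Re (u n) - l| @[n --> \oo] --> (0 : R).
  apply: real_complete => e /uC[n0 un0]; exists n0 => m n n0m n0n.
  apply: le_lt_trans (un0 _ _ n0m n0n).
  by rewrite -raddfB; have [] := normc_ge_ReIm (u m - u n).
have [b ub] : exists l, `|complex.Im (u n) - l| @[n --> \oo] --> (0 : R).
  apply: real_complete => e /uC[n0 un0]; exists n0 => m n n0m n0n.
  apply: le_lt_trans (un0 _ _ n0m n0n).
  by rewrite -raddfB; have [] := normc_ge_ReIm (u m - u n).
exists (a +i* b).
have sq : (fun n => `|complex.Re (u n) - a| + `|complex.Im (u n) - b|) @ \oo -->
    (0 : R).
  by rewrite -[0 in X in _ --> X](addr0 0); apply: cvgD.
apply: (squeeze_cvgr _ (cvg_cst 0) sq); apply: nearW => n; apply/andP; split.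
  by case: (_ - _) => ? ?; exact: sqrtr_ge0.
by have := normc_le_ReIm (u n - (a +i* b)); rewrite !raddfB.
Qed.

End ComplexNumbers.

Definition complex_cstar (R : realType) : cstar R.
Proof.
refine (@Cstar R R[i]^o *%R (@conjc R) (@normc R) _ _ _ _ _ _ _ _ _ _ _ _
          (@complex_complete R)).
- exact: mulrA.
- by move=> b z x y; rewrite mulrDl scalerAl.
- by move=> a z x y; rewrite mulrDr scalerAr.
- exact: rmorphD.
- exact: rmorphM.
- by move=> a b; rewrite rmorphM mulrC.
- exact: conjcK.
- exact: eq0_normc.
- exact: le_normcD.
- exact: normcM.
- by move=> a b; rewrite normcM.
- move=> a; rewrite normcM expr2; congr (_ * _).
  by case: a => a b /=; rewrite sqrrN.
Defined.

Section Regular.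
Variables (R : realType) (A : cstar R).

Lemma cnrm0 : cnrm (0 : A) = 0.
Proof. by rewrite -(scale0r (0 : A)) cnrmZ normc0 mul0r. Qed.

Lemma cnrm_ge0 (a : A) : 0 <= cnrm a.
Proof.
have := cnrmD a (- a); rewrite subrr cnrm0 -scaleN1r cnrmZ normcN normc1 mul1r.
by rewrite -mulr2n pmulrn_lge0.
Qed.

Lemma sqrt_cnrm_star (a : A) : Num.sqrt (cnrm (cmul (cstr a) a)) = cnrm a.
Proof. by rewrite cnrm_star sqrtr_sqr ger0_norm // cnrm_ge0. Qed.

(* A as a Hilbert module over itself, and as a correspondence. *)
Definition regular_hmod : hmod A.
Proof.
refine (@Hmod R A A (@cmul R A) (fun a b => cmul (cstr a) b)
          _ _ _ _ _ _ _ _ _).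
- exact: cmul_linl.
- exact: cmul_linr.
- by move=> x b c; rewrite cmulA.
- by move=> x; exact: cmul_linr.
- by move=> x y b; rewrite cmulA.
- by move=> x y; rewrite cstrM cstrK.
- by move=> x; exists x.
- move=> x xx0; apply: cnrm_eq0; have := cnrm_star x.
  by rewrite xx0 cnrm0 => /esym/eqP; rewrite expf_eq0 => /andP[_ /eqP].
- move=> u uC; have [|l ul] := @ccomplete R A u.
    move=> e /uC[n0 un0]; exists n0 => m n n0m n0n.
    by rewrite -sqrt_cnrm_star; exact: un0.
  exists l; rewrite (_ : (fun n => _) = (fun n => cnrm (u n - l))) //.
  by apply/funext => n; rewrite sqrt_cnrm_star.
Defined.

Definition regular : corr A A.
Proof.
refine (@Corr R A A regular_hmod (@cmul R A) _ _ _ _ _ _).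
- exact: cmul_linl.
- exact: cmul_linr.
- by move=> a b x; rewrite -cmulA.
- by move=> a x y; rewrite /= cstrM cmulA.
- by move=> a x b; rewrite /= cmulA.
- by move=> a x; rewrite /hnrm /= !sqrt_cnrm_star cnrmM.
Defined.

End Regular.

(* The closed subcorrespondence [sub P] of F generated by a set P; for P already
   closed and invariant this is P itself, with its restricted structure. *)
Section Sub.
Variables (R : realType) (A B : cstar R) (F : corr A B).

Record closed_invariant (Q : set F) : Prop := {
  clin_0 : Q 0;
  clin_lin : forall (z : R[i]) x y, Q x -> Q y -> Q (z *: x + y);
  clin_ract : forall x b, Q x -> Q (ract x b);
  clin_lact : forall a x, Q x -> Q (lact a x);
  clin_closed : forall x,
    (forall e : R, 0 < e -> exists2 y, Q y & hnrm (y - x) < e) -> Q x }.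

Definition cspan (P : set F) : set F :=
  [set x | forall Q, closed_invariant Q -> P `<=` Q -> Q x].

Lemma cspanP (P : set F) : closed_invariant (cspan P).
Proof.
split=> [Q QC _|z x y Px Py Q QC PQ|x b Px Q QC PQ|a x Px Q QC PQ|x Px Q QC PQ].
- exact: clin_0.
- by apply: (clin_lin QC); [exact: Px|exact: Py].
- by apply: (clin_ract QC); exact: Px.
- by apply: (clin_lact QC); exact: Px.
- apply: (clin_closed QC) => e /Px[y Py xy]; exists y => //.
  exact: Py.
Qed.

Variable P : set F.

Definition cspan_pred : {pred F} := [pred x | `[< cspan P x >]].

Lemma cspan_submod_closed : submod_closed cspan_pred.
Proof.
split=> [|z x y /asboolP Px /asboolP Py]; apply/asboolP.
  exact: (clin_0 (cspanP P)).
exact: (clin_lin (cspanP P)).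
Qed.

HB.instance Definition _ := GRing.isSubmodClosed.Build _ _ cspan_pred
  cspan_submod_closed.

Definition sub_sort : Type := {x : F | cspan_pred x}.
HB.instance Definition _ := SubChoice.on sub_sort.
HB.instance Definition _ := [SubChoice_isSubLmodule of sub_sort by <:].

Definition sub_elt (x : F) (Px : cspan P x) : sub_sort := exist _ x (asboolT Px).
Lemma sub_eltP (x : sub_sort) : cspan P (val x).
Proof. exact: (asboolW (valP x)). Qed.

Definition sub_hmod : hmod B.
Proof.
refine (@Hmod R B sub_sort
  (fun x b => sub_elt (clin_ract (cspanP P) b (sub_eltP x)))
  (fun x y => ip (val x) (val y)) _ _ _ _ _ _ _ _ _).
- by move=> b z x y; apply: val_inj; rewrite /= ract_linl.
- by move=> x z b c; apply: val_inj; rewrite /= ract_linr.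
- by move=> x b c; apply: val_inj; rewrite /= ractM.
- by move=> x z y y'; rewrite /= ip_linr.
- by move=> x y b; rewrite /= ip_ract.
- by move=> x y; rewrite ip_star.
- by move=> x; exact: ip_ge0.
- by move=> x /ip_eq0 x0; apply: val_inj.
- move=> u uC; have [|l ul] := @hcomplete R B F (fun n => val (u n)).
    move=> e /uC[n0 un0]; exists n0 => m n n0m n0n.
    by rewrite -raddfB; exact: un0.
  have Pl : cspan P l.
    apply: (clin_closed (cspanP P)) => e e0.
    have /cvgrPdist_lt/(_ e e0)[n0 _ /(_ n0 (leqnn _))] := ul.
    rewrite /= sub0r normrN ger0_norm ?sqrtr_ge0// => ue.
    exists (val (u n0)); first exact: sub_eltP.
    exact: ue.
  by exists (sub_elt Pl).
Defined.

End Sub.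

Definition sub (R : realType) (A B : cstar R) (F : corr A B) (P : set F) :
  corr A B.
Proof.
refine (@Corr R A B (sub_hmod P)
  (fun a x => sub_elt (clin_lact (cspanP P) a (sub_eltP x))) _ _ _ _ _ _).
- by move=> x z a b; apply: val_inj; rewrite /= lact_linl.
- by move=> a z x y; apply: val_inj; rewrite /= lact_linr.
- by move=> a b x; apply: val_inj; rewrite /= lactM.
- by move=> a x y; rewrite /= lact_adj.
- by move=> a x b; apply: val_inj; rewrite /= lact_ract.
- by move=> a x; exact: lact_nrm.
Defined.

Definition sub_in (R : realType) (A B : cstar R) (F : corr A B) (P : set F)
  (x : sub P) : F := val (x : sub_sort P).

(* Interior tensor products, characterized up to unitary isomorphism. *)
Record tensor (R : realType) (A B D : cstar R) (E : corr A B) (F : corr B D) :=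
  Tensor {
  tcorr :> corr A D;
  tmul : E -> F -> tcorr;
  tmul_linl : forall y, linear (fun x => tmul x y);
  tmul_linr : forall x, linear (tmul x);
  tmul_ip : forall x y x' y',
    ip (tmul x y) (tmul x' y') = ip y (lact (ip x x') y');
  tmul_lact : forall a x y, lact a (tmul x y) = tmul (lact a x) y;
  tmul_ract : forall x y d, ract (tmul x y) d = tmul x (ract y d);
  tmul_dense : forall (z : tcorr) (e : R), 0 < e ->
    exists s : seq (E * F), hnrm (z - \sum_(p <- s) tmul p.1 p.2) < e }.

(* Hilbert-module direct sums of sequences, characterized up to unitary
   isomorphism. *)
Record dsum (R : realType) (A B : cstar R) (E : nat -> corr A B) := Dsum {
  dcorr :> corr A B;
  din : forall n, E n -> dcorr;
  din_lin : forall n, linear (din (n := n));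
  din_ip : forall n x y, ip (din (n := n) x) (din (n := n) y) = ip x y;
  din_orth : forall m n x y, m <> n -> ip (din (n := m) x) (din (n := n) y) = 0;
  din_lact : forall n a x, lact a (din (n := n) x) = din (lact a x);
  din_ract : forall n x b, ract (din (n := n) x) b = din (ract x b);
  din_dense : forall (z : dcorr) (e : R), 0 < e ->
    exists N (x : forall n, E n), hnrm (z - \sum_(n < N) din (x n)) < e }.

(* A choice of interior tensor products and of direct sums. *)
Record models (R : realType) := Models {
  tensor_of : forall (A B D : cstar R) (E : corr A B) (F : corr B D), tensor E F;
  dsum_of : forall (A B : cstar R) (E : nat -> corr A B), dsum E }.

Section Operators.
Variable R : realType.

Definition bounded_op (B B' : cstar R) (F : hmod B) (G : hmod B') (T : F -> G) :=
  linear T /\ exists c : R, forall x, hnrm (T x) <= c * hnrm x.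

(* The bounded operator specified by P (0 if there is none); every use below
   has a unique solution for isometric representations. *)
Definition the_op (B B' : cstar R) (F : hmod B) (G : hmod B')
  (P : (F -> G) -> Prop) : F -> G :=
  xget (fun=> 0) [set T | bounded_op T /\ P T].

Variable B : cstar R.
Implicit Types F G : hmod B.

Definition isometric_op F G (T : F -> G) :=
  bounded_op T /\ forall x y, ip (T x) (T y) = ip x y.

Definition unitary_op F G (T : F -> G) :=
  isometric_op T /\ forall y, exists x, T x = y.

Definition adj F G (T : F -> G) : G -> F :=
  the_op (fun S => forall x y, ip (T x) y = ip x (S y)).

(* For an injective j regarded as an identification, x as an element of G. *)
Definition pull F G (j : G -> F) (x : F) : G := xget 0 [set y | j y = x].

Definition ominus F (S : set F) : set F :=
  [set h | forall k, S k -> ip k h = 0].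

(* F is the orthogonal direct sum of F1 and F2, embedded by i and j. *)
Definition orth_decomp F F1 F2 (i : F1 -> F) (j : F2 -> F) : Prop :=
  [/\ isometric_op i, isometric_op j, forall x y, ip (i x) (j y) = 0 &
      forall z, exists x y, z = i x + j y].

End Operators.

Definition incl (R : realType) (A B : cstar R) (F : corr A B) (P Q : set F)
  (x : sub P) : sub Q := pull (@sub_in R A B F Q) (sub_in x).
Arguments incl {R A B F} P Q x.

Section Tensors.
Variables (R : realType) (M : models R).

Definition tprod (A B D : cstar R) (E : corr A B) (F : corr B D) : corr A D :=
  tensor_of M E F.

Definition ten (A B D : cstar R) (E : corr A B) (F : corr B D) (x : E) (y : F) :
  tprod E F := tmul (tensor_of M E F) x y.

Definition textend (A B D D' : cstar R) (E : corr A B) (F : corr B D)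
  (G : hmod D') (f : E -> F -> G) : tprod E F -> G :=
  the_op (fun T => forall x y, T (ten x y) = f x y).

Definition tmap (A B D : cstar R) (E E' : corr A B) (F F' : corr B D)
  (f : E -> E') (g : F -> F') : tprod E F -> tprod E' F' :=
  textend (fun x y => ten (f x) (g y)).

Definition tassoc (A B D G : cstar R)
  (X : corr A B) (Y : corr B D) (Z : corr D G) :
  tprod (tprod X Y) Z -> tprod X (tprod Y Z) :=
  the_op (fun T => forall x y z, T (ten (ten x y) z) = ten x (ten y z)).

Definition tassocV (A B D G : cstar R)
  (X : corr A B) (Y : corr B D) (Z : corr D G) :
  tprod X (tprod Y Z) -> tprod (tprod X Y) Z :=
  the_op (fun T => forall x y z, T (ten x (ten y z)) = ten (ten x y) z).

End Tensors.

(* Hilbert spaces with a representation of A. *)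
Notation rep A := (corr A (complex_cstar _)).

Section Representations.
Variables (R : realType) (A : cstar R).

(* For a matrix over a Hilbert module F, the norm of M_n(F) is the norm of the
   induced operator A^n -> F^n. *)
Definition col_nrm (B : cstar R) (F : hmod B) n (x : 'I_n -> F) : R :=
  Num.sqrt (cnrm (\sum_i ip (x i) (x i))).

Definition mx_nrm_le (F : hmod A) n (xi : 'I_n -> 'I_n -> F) (k : R) : Prop :=
  forall b : 'I_n -> regular A,
    col_nrm (fun i => \sum_j ract (xi i j) (b j)) <= k * col_nrm b.

Definition completely_bounded (E : hmod A) (H : rep A) (V : E -> H -> H) : Prop :=
  exists c : R, forall n (xi : 'I_n -> 'I_n -> E) (k : R),
    0 <= k -> mx_nrm_le xi k -> forall h : 'I_n -> H,
    col_nrm (fun i => \sum_j V (xi i j) (h j)) <= c * k * col_nrm h.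

(* sigma is the left action carried by H. *)
Record covrep (E : corr A A) (H : rep A) (V : E -> H -> H) : Prop := {
  cov_nondegenerate : nondegenerate H;
  cov_bounded : forall xi, bounded_op (V xi);
  cov_linear : forall h, linear (fun xi => V xi h);
  cov_bimodule : forall b xi a h,
    V (lact b (ract xi a)) h = lact b (V xi (lact a h));
  cov_cb : completely_bounded V }.

(* V(eta)^* V(xi) = sigma(<eta, xi>) *)
Definition isometric_rep (E : corr A A) (H : rep A) (V : E -> H -> H) : Prop :=
  forall eta xi h k, ip (V eta h) (V xi k) = ip h (lact (ip eta xi) k).

End Representations.

Section Fock.
Variables (R : realType) (M : models R) (A : cstar R) (E : corr A A).

Fixpoint tpower n : corr A A :=
  if n is m.+1 then tprod M E (tpower m) else regular A.

Definition fock : corr A A := dsum_of M tpower.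

Definition fock_in n (x : tpower n) : fock := din (dsum_of M tpower) x.

(* The identification of K with the n = 0 summand of F(E) (x) K. *)
Definition vacuum (K : rep A) : K -> tprod M fock K :=
  the_op (fun T => forall (a : A) k,
    T (lact a k) = ten M (fock_in (n := 0) a) k).

(* The induced representation (rho, S) on F(E) (x) K; rho is the left action. *)
Definition creation (K : rep A) (xi : E) : tprod M fock K -> tprod M fock K :=
  the_op (fun T => forall n (eta : tpower n) k,
    T (ten M (fock_in eta) k) =
    ten M (fock_in (n := n.+1) (ten M xi eta)) k).

End Fock.
Arguments vacuum {R} M {A} E K _.
Arguments creation {R} M {A} E K xi _.

Section Wold.
Variables (R : realType) (M : models R) (A : cstar R).
Variables (E : corr A A) (H : rep A) (V : E -> H -> H).

Definition tilde : tprod M E H -> H := textend V.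

Fixpoint tilde_iter n : tprod M (tpower M E n) H -> H :=
  if n is m.+1 then fun z => tilde (tmap id (tilde_iter (n := m)) (tassoc z))
  else textend (fun (a : regular A) h => lact a h).

Definition pure_rep : Prop := forall h,
  hnrm (tilde_iter (adj (tilde_iter (n := n)) h)) @[n --> \oo] --> (0 : R).

(* H (-) V~(E (x) H) *)
Definition wset : set H := ominus (range tilde).

Definition wandering : rep A := sub wset.

Definition wold : H -> tprod M (fock M E) wandering :=
  the_op (fun P => unitary_op P /\
    forall n (eta : tpower M E n) (w : wandering),
      P (tilde_iter (ten M eta (sub_in w))) = ten M (fock_in eta) w).

End Wold.
Arguments tilde {R} M {A E H} V _.

(* Product systems over N_0^2; t12 is the inverse of t21. *)
Record product_system (R : realType) (M : models R) (A : cstar R) :=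
  ProductSystem {
  ps1 : corr A A;
  ps2 : corr A A;
  t21 : tprod M ps2 ps1 -> tprod M ps1 ps2;
  t12 : tprod M ps1 ps2 -> tprod M ps2 ps1;
  ps1_nondegenerate : nondegenerate ps1;
  ps2_nondegenerate : nondegenerate ps2;
  t21_unitary : unitary_op t21;
  t21_lact : forall a x, t21 (lact a x) = lact a (t21 x);
  t21_ract : forall x b, t21 (ract x b) = ract (t21 x) b;
  t21K : cancel t21 t12;
  t12K : cancel t12 t21 }.

Section ProductSystem.
Variables (R : realType) (M : models R) (A : cstar R).
Variables (P : product_system M A) (H : rep A).

Definition ps_prod : corr A A := tprod M (ps1 P) (ps2 P).

Record ps_covrep (V1 : ps1 P -> H -> H) (V2 : ps2 P -> H -> H) : Prop := {
  psc_cov1 : covrep V1;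
  psc_cov2 : covrep V2;
  psc_comm : forall z : tprod M ps_prod H,
    tilde M V1 (tmap id (tilde M V2) (tassoc z)) =
    tilde M V2 (tmap id (tilde M V1) (tassoc (tmap (@t12 _ _ _ P) id z))) }.

Definition ps_isometric (V1 : ps1 P -> H -> H) (V2 : ps2 P -> H -> H) : Prop :=
  [/\ ps_covrep V1 V2, isometric_rep V1 & isometric_rep V2].

(* The representation V of E = E_1 (x) E_2 with
   V~ = V1~ (I (x) V2~). *)
Definition ps_rep (V1 : ps1 P -> H -> H) (V2 : ps2 P -> H -> H) :
  ps_prod -> H -> H :=
  fun xi h => tilde M V1 (tmap id (tilde M V2) (tassoc (ten M xi h))).

End ProductSystem.

(* The BCL-representation: V is a pure isometric representation of E, and
   U is one of V1, V2. *)
Section BCL.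
Variables (R : realType) (M : models R) (A : cstar R).
Variables (E E' : corr A A) (H : rep A) (V : E -> H -> H) (U : E' -> H -> H).

Let W : rep A := wandering M V.

Definition bcl (xi : E') : tprod M (fock M E) W -> tprod M (fock M E) W :=
  fun x => wold M V (U xi (adj (wold M V) x)).

Definition Theta (xi : E') : W -> tprod M (fock M E) W :=
  fun w => bcl xi (vacuum M E W w).

Definition Theta_tilde : tprod M E' W -> tprod M (fock M E) W := textend Theta.

End BCL.
Arguments Theta_tilde {R} M {A E E' H} V U _.

Section Restrictions.
Variables (R : realType) (M : models R) (A : cstar R).
Variables (E : corr A A) (H : rep A) (V : E -> H -> H) (P Q : set H).

(* V~ on E (x) K, for K = [sub P], as an operator into [sub Q]. *)
Definition tilde_restr : tprod M E (sub P) -> sub Q :=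
  fun x => pull (@sub_in _ _ _ H Q) (tilde M V (tmap id (@sub_in _ _ _ H P) x)).

(* V~(E (x) K) *)
Definition tilde_image : set H :=
  range (fun x : tprod M E (sub P) => tilde M V (tmap id (@sub_in _ _ _ H P) x)).

(* V~^* on V~(E (x) K), as an operator onto E (x) K. *)
Definition tilde_adj_restr : sub tilde_image -> tprod M E (sub P) :=
  fun h => pull (tmap id (@sub_in _ _ _ H P)) (adj (tilde M V) (sub_in h)).

End Restrictions.
Arguments tilde_restr {R} M {A E H} V P Q _.
Arguments tilde_adj_restr {R} M {A E H} V P _.

(* Main.v *)
Require Import Defs.
From HB Require Import structures.
From mathcomp Require Import all_boot all_order all_algebra.
From mathcomp Require Import boolp classical_sets reals topology normedtype.
From mathcomp Require Import sequences.
From mathcomp.real_closed Require Import complex.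
From mathcomp Require Import ring lra.

Set Implicit Arguments.
Unset Strict Implicit.
Unset Printing Implicit Defensive.

Import Order.TTheory GRing.Theory Num.Theory ComplexField Normc.
Import numFieldNormedType.Exports.

Local Open Scope classical_set_scope.
Local Open Scope ring_scope.
Local Open Scope complex_scope.

(* Up to adjoints, the operators in the statement come from isometries between
   Hilbert spaces, each of which is determined by, and can be built from, its
   values on a family with trivial orthogonal complement.  The Wold unitary Pi
   restricts to the vacuum embedding on W and carries V(e)w, for w in W, to
   S(e)w, so Theta~_i is the restriction of Pi V~^(i) to E_i (x) W.  At
   xi (x) V^(2)(eta)w with w in W_1 it takes the value
   Pi V(xi (x) eta)w = S(xi (x) eta)w, while V~^(1) maps E_1 (x) W_2 into W,
   where Pi is the vacuum embedding.  The case i = 2 is the same with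
   t_{2,1}(eta (x) xi) in place of xi (x) eta. *)

(** Operators selected by [the_op] are known only once a bounded solution is exhibited, and their
    uniqueness must be proved before they can be computed with. Orthogonal complements are available
    only over [complex_cstar]. In a tensor product they control the rightmost, Hilbert, factor; the
    factors on the left are modules over [A], where genuine density by finite sums is used instead.
    The algebra need not have a unit, so a vector of [W] is not an elementary tensor of degree 0.
    Nondegeneracy replaces the unit: identities are tested on vectors [lact a w]. To serve both
    values of i, the two-factor arguments use an isometric surjection [theta] from [E1 (x) E2] to
    [E] and another, [theta'], from [E2 (x) E1]. The case i = 1 takes the identity and [t21] for
    them; the case i = 2 exchanges the factors and these two maps. *)

Lemma le0_small (R : realFieldType) (x c : R) :
  (forall e, 0 < e -> x <= c * e) -> x <= 0.
Proof.
move=> xc; rewrite leNgt; apply/negP => x0.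
have c0 : 0 < c by have := xc 1 ltr01; rewrite mulr1; exact: lt_le_trans.
have := xc (x / (2 * c)) (divr_gt0 x0 (mulr_gt0 (ltr0Sn _ 1) c0)).
rewrite (_ : c * (x / (2 * c)) = x / 2); last by field; rewrite gt_eqF.
lra.
Qed.

(** * Inner products and isometries *)

Section InnerProduct.
Variables (R : realType) (B : cstar R) (F : hmod B).
Implicit Types x y z : F.

Lemma ipDr x y z : ip x (y + z) = ip x y + ip x z.
Proof. by have := ip_linr x 1 y z; rewrite !scale1r. Qed.
Lemma ip0r x : ip x 0 = 0.
Proof. by apply: (addIr (ip x 0)); rewrite -ipDr !add0r. Qed.
Lemma ipZr a x y : ip x (a *: y) = a *: ip x y.
Proof. by have := ip_linr x a y 0; rewrite ip0r !addr0. Qed.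
Lemma ipNr x y : ip x (- y) = - ip x y.
Proof. by rewrite -scaleN1r ipZr scaleN1r. Qed.
Lemma ipBr x y z : ip x (y - z) = ip x y - ip x z.
Proof. by rewrite ipDr ipNr. Qed.
Lemma ipDl x y z : ip (x + y) z = ip x z + ip y z.
Proof. by rewrite -ip_star ipDr cstrD !ip_star. Qed.
Lemma ipZl a x y : ip (a *: x) y = conjc a *: ip x y.
Proof. by rewrite -ip_star ipZr cstrZ !ip_star. Qed.
Lemma ipNl x y : ip (- x) y = - ip x y.
Proof. by rewrite -scaleN1r ipZl rmorphN rmorph1 scaleN1r. Qed.
Lemma ip0l x : ip 0 x = 0.
Proof. by rewrite -(scale0r 0) ipZl rmorph0 scale0r. Qed.
Lemma ipBl x y z : ip (x - y) z = ip x z - ip y z.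
Proof. by rewrite ipDl ipNl. Qed.
Lemma ip_suml I (s : seq I) (f : I -> F) x :
  ip (\sum_(i <- s) f i) x = \sum_(i <- s) ip (f i) x.
Proof.
elim: s => [|i s IH]; first by rewrite !big_nil ip0l.
by rewrite !big_cons ipDl IH.
Qed.
Lemma ip_sym0 x y : ip x y = 0 -> ip y x = 0.
Proof.
move=> xy0; rewrite -ip_star xy0 -(scale0r 0) cstrZ.
by rewrite rmorph0 !scale0r.
Qed.
Lemma ip_inj x y : (forall z, ip z x = ip z y) -> x = y.
Proof.
move=> xy; apply/eqP; rewrite -subr_eq0; apply/eqP/ip_eq0.
by rewrite ipBr xy subrr.
Qed.
Lemma hnrm_ge0 x : 0 <= hnrm x. Proof. exact: sqrtr_ge0. Qed.
Lemma hnrm_eq0 x : hnrm x = 0 -> x = 0.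
Proof.
move/eqP; rewrite sqrtr_eq0 => x0; apply/ip_eq0/cnrm_eq0.
by apply/le_anti; rewrite x0 cnrm_ge0.
Qed.
Lemma hnrm_sqr x : hnrm x ^+ 2 = cnrm (ip x x).
Proof. by rewrite sqr_sqrtr // cnrm_ge0. Qed.

End InnerProduct.

Section Isom.
Variables (R : realType) (B : cstar R).

Definition isom (F G : hmod B) (T : F -> G) :=
  forall x y, ip (T x) (T y) = ip x y.

(** The defect of linearity is orthogonal to every value of [T] and is itself a combination of such
    values, hence orthogonal to itself. *)
Lemma isom_linear (F G : hmod B) (T : F -> G) : isom T -> linear T.
Proof.
move=> iT a x y; apply/eqP; rewrite -subr_eq0; apply/eqP/ip_eq0.
set d := _ - _; have Td z : ip (T z) d = 0.
  by rewrite ipBr ipDr ipZr !iT ipDr ipZr subrr.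
by rewrite {1}/d ipBl ipDl ipZl !Td scaler0 addr0 subrr.
Qed.

Lemma isom_hnrm (F G : hmod B) (T : F -> G) x : isom T -> hnrm (T x) = hnrm x.
Proof. by move=> iT; rewrite /hnrm iT. Qed.

Lemma isom_bounded (F G : hmod B) (T : F -> G) : isom T -> bounded_op T.
Proof.
move=> iT; split; first exact: isom_linear.
by exists 1 => x; rewrite mul1r isom_hnrm.
Qed.

Lemma isom_inj (F G : hmod B) (T : F -> G) : isom T -> injective T.
Proof.
move=> iT x y Txy; apply: ip_inj => z.
by rewrite -[LHS]iT Txy iT.
Qed.

Lemma isom_comp (F G K : hmod B) (S : G -> K) (T : F -> G) :
  isom S -> isom T -> isom (fun x => S (T x)).
Proof. by move=> iS iT x y; rewrite iS iT. Qed.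

End Isom.

(** * Hilbert spaces and their real inner product *)

Notation hilb R := (hmod (complex_cstar R)).

Section Hilbert.
Variables (R : realType).
Implicit Types (F G : hilb R).

(** Inequalities and minimization take place in the reals; [ip_ripE] recovers the complex inner
    product from this real one. *)
Definition rip F (x y : F) : R := complex.Re (ip x y : R[i]).

Lemma rip_sym F (x y : F) : rip x y = rip y x.
Proof. by rewrite /rip -(ip_star y x) /=; case: (ip y x : R[i]). Qed.
Lemma ripDr F (x y z : F) : rip x (y + z) = rip x y + rip x z.
Proof. by rewrite /rip ipDr raddfD. Qed.
Lemma ripZr F (a : R) (x y : F) : rip x (a%:C *: y) = a * rip x y.
Proof.
rewrite /rip ipZr.
change (complex.Re (a%:C * (ip x y : R[i])) = a * complex.Re (ip x y : R[i])).
by case: (ip x y : R[i]) => u v /=; rewrite mul0r subr0.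
Qed.
Lemma ripNr F (x y : F) : rip x (- y) = - rip x y.
Proof. by rewrite /rip ipNr raddfN. Qed.
Lemma ripBr F (x y z : F) : rip x (y - z) = rip x y - rip x z.
Proof. by rewrite ripDr ripNr. Qed.
Lemma ripDl F (x y z : F) : rip (y + z) x = rip y x + rip z x.
Proof. by rewrite rip_sym ripDr !(rip_sym x). Qed.
Lemma ripZl F (a : R) (x y : F) : rip (a%:C *: x) y = a * rip x y.
Proof. by rewrite rip_sym ripZr rip_sym. Qed.
Lemma ripNl F (x y : F) : rip (- x) y = - rip x y.
Proof. by rewrite rip_sym ripNr rip_sym. Qed.
Lemma ripBl F (x y z : F) : rip (y - z) x = rip y x - rip z x.
Proof. by rewrite ripDl ripNl. Qed.

(** The norm is defined through the modulus of [ip x x]; positivity writes [ip x x] as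
    [conjc b * b], whose modulus is its real part. *)
Lemma rip_hnrm F (x : F) : rip x x = hnrm x ^+ 2.
Proof.
rewrite hnrm_sqr /rip; have [b ->] := ip_ge0 x.
rewrite /=; case: b => u v /=.
have -> : u * v + - v * u = 0 by ring.
rewrite expr0n addr0 sqrtr_sqr ger0_norm //.
have -> : u * u - - v * v = u ^+ 2 + v ^+ 2 by ring.
by rewrite addr_ge0 ?sqr_ge0.
Qed.

Lemma ip_ripE F (x y : F) :
  (ip x y : R[i]) = rip x y +i* (- rip x ('i *: y)).
Proof.
rewrite /rip ipZr.
change ((ip x y : R[i]) = complex.Re (ip x y : R[i]) +i* (- complex.Re ('i * (ip x y : R[i])))).
by case: (ip x y : R[i]) => u v /=; congr (_ +i* _); ring.
Qed.

Lemma hnrmZ F (a : R[i]) (x : F) : hnrm (a *: x) = normc a * hnrm x.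
Proof.
have nJ : normc (conjc a) = normc a by case: a => u v /=; rewrite sqrrN.
rewrite /hnrm ipZr ipZl !cnrmZ nJ mulrA -expr2.
by rewrite sqrtrM ?sqr_ge0 // sqrtr_sqr ger0_norm //; case: a {nJ} => ? ?; exact: sqrtr_ge0.
Qed.

Lemma hnrm0 F : hnrm (0 : F) = 0.
Proof. by rewrite -(scale0r (0 : F)) hnrmZ normc0 mul0r. Qed.
Lemma hnrmN F (x : F) : hnrm (- x) = hnrm x.
Proof. by rewrite -scaleN1r hnrmZ normcN normc1 mul1r. Qed.
Lemma hnrmBC F (x y : F) : hnrm (x - y) = hnrm (y - x).
Proof. by rewrite -hnrmN opprB. Qed.

(** Cauchy-Schwarz: with [p], [q] the norms of [x], [y], the squared norm of [q x - p y] equals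
    [2 p q (p q - rip x y)]. *)
Lemma rip_le F (x y : F) : rip x y <= hnrm x * hnrm y.
Proof.
have [/eqP|x0] := eqVneq (hnrm x) 0.
  by move/eqP=> /hnrm_eq0 ->; rewrite hnrm0 mul0r /rip ip0l.
have xp : 0 < hnrm x by rewrite lt_def x0 hnrm_ge0.
set p := hnrm x in x0 xp *; set q := hnrm y.
have : 0 <= rip (q%:C *: x - p%:C *: y) (q%:C *: x - p%:C *: y).
  by rewrite rip_hnrm sqr_ge0.
rewrite !(ripBl, ripBr, ripZl, ripZr) !rip_hnrm (rip_sym y x) -/p -/q.
have := hnrm_ge0 y; rewrite -/q le0r => /orP[/eqP q0|q0].
  by rewrite q0 mulr0 (hnrm_eq0 q0) /rip ip0r.
set r := rip x y => h.
have : 0 <= (p * q) * (p * q - r) by nra.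
by rewrite pmulr_rge0 ?mulr_gt0 // subr_ge0.
Qed.

Lemma hnrmD F (x y : F) : hnrm (x + y) <= hnrm x + hnrm y.
Proof.
rewrite -(@ler_pXn2r _ 2) ?nnegrE ?addr_ge0 ?hnrm_ge0 //.
rewrite -rip_hnrm ripDr !ripDl !rip_hnrm (rip_sym y x).
have := rip_le x y; lra.
Qed.

Lemma hnrmB_le F (z x y : F) : hnrm (x - y) <= hnrm (x - z) + hnrm (z - y).
Proof. by rewrite -(subrKA z x (- y)) hnrmD. Qed.

Lemma rip_abs_le F (x y : F) : `|rip x y| <= hnrm x * hnrm y.
Proof.
rewrite ler_norml rip_le andbT lerNl -ripNr.
by rewrite (le_trans (rip_le _ _)) // hnrmN.
Qed.

(** The factor 2 comes from bounding the modulus by the sum of the real and imaginary parts; it is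
    harmless because the bound only serves continuity arguments. *)
Lemma normc_ip_le F (x y : F) : normc (ip x y : R[i]) <= 2 * (hnrm x * hnrm y).
Proof.
apply: le_trans (normc_le_ReIm _) _; rewrite ip_ripE /= normrN.
have := rip_abs_le x y; have := rip_abs_le x ('i *: y).
have n1 : normc ('i : R[i]) = 1 by rewrite /= expr0n add0r expr1n sqrtr1.
by rewrite hnrmZ n1 mul1r; lra.
Qed.

End Hilbert.

(** * Closed subspaces and extension of isometries *)

Section Closed.
Variables (R : realType).
Implicit Types (F G : hilb R).

(** Completeness without sequences: [Q d x] reads as [x] being an approximate solution at scale [d].
    A choice at the scales [1/(n+1)] is Cauchy, and near its limit there are solutions of
    arbitrarily small scale. *)
Lemma complete_family F (Q : R -> F -> Prop) :
  (forall d, 0 < d -> exists x, Q d x) ->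
  (forall e, 0 < e -> exists2 d0, 0 < d0 & forall a b x y,
     a < d0 -> b < d0 -> Q a x -> Q b y -> hnrm (x - y) < e) ->
  exists l, forall e, 0 < e ->
    exists d x, [/\ 0 < d, d < e, Q d x & hnrm (x - l) < e].
Proof.
move=> Qe QC.
have inv0 n : 0 < n.+1%:R^-1 :> R by rewrite invr_gt0.
have small (d : R) : 0 < d ->
    exists n0, forall n, (n0 <= n)%N -> n.+1%:R^-1 < d.
  move=> d0; exists (Num.bound d^-1) => n nd.
  rewrite invf_plt ?posrE //.
  rewrite (lt_le_trans (archi_boundP _)) ?invr_ge0 ?(ltW d0) // ler_nat.
  exact: leqW.
have /choice[u uQ] (n : nat) := Qe _ (inv0 n).
have [|l ul] := @hcomplete _ _ F u.
  move=> e /QC[d0 /small[n0 n0P] d0P]; exists n0 => m n mn nn.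
  exact: (d0P _ _ _ _ (n0P _ mn) (n0P _ nn)).
exists l => e e0; have [n0 n0P] := small _ e0.
have /cvgrPdist_lt/(_ e e0)[n1 _ n1P] := ul.
have := n1P (maxn n0 n1) (leq_maxr _ _).
rewrite /= sub0r normrN ger0_norm ?sqrtr_ge0// => ue.
exists ((maxn n0 n1).+1%:R^-1), (u (maxn n0 n1)); split=> //.
by apply: n0P; rewrite leq_maxl.
Qed.

(** A predicate rather than a type, so that it also covers properties of vectors: these are the
    properties that [total_ind] extends from a total family to the whole space. *)
Record closed_sub F (Q : F -> Prop) : Prop := ClosedSub {
  closed_sub0 : Q 0;
  closed_sub_lin : forall (a : R[i]) x y, Q x -> Q y -> Q (a *: x + y);
  closed_sub_lim : forall x,
    (forall e, 0 < e -> exists2 y, Q y & hnrm (y - x) < e) -> Q x }.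

Lemma ip_eq0_rip F (x y : F) :
  rip x y = 0 -> rip x ('i *: y) = 0 -> ip x y = 0.
Proof. by move=> xy0 xiy0; have := ip_ripE x y; rewrite xy0 xiy0 oppr0. Qed.

Lemma rip_min F (s q : F) :
  (forall t : R, hnrm q <= hnrm (q - t%:C *: s)) -> rip s q = 0.
Proof.
move=> tq; set r := rip s q; set n := rip s s.
have n0 : 0 <= n by rewrite /n rip_hnrm sqr_ge0.
have {}tq (t : R) : 0 <= - 2 * t * r + t ^+ 2 * n.
  have := tq t; rewrite -(@ler_pXn2r _ 2) ?nnegrE ?hnrm_ge0 // -!rip_hnrm.
  rewrite !(ripBl, ripBr, ripZl, ripZr) (rip_sym q s) -/r -/n; nra.
have n1 : 0 < n + 1 by lra.
(* The quadratic is minimal at [r / n]; the added 1 covers [s = 0] and still gives a negative value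
   unless [r = 0]. *)
have := tq (r / (n + 1)).
have -> : - 2 * (r / (n + 1)) * r + (r / (n + 1)) ^+ 2 * n =
          - (r ^+ 2 * ((n + 2) / (n + 1) ^+ 2)) by field; rewrite gt_eqF.
have k0 : 0 < (n + 2) / (n + 1) ^+ 2.
  by rewrite divr_gt0 ?exprn_gt0 //; lra.
rewrite oppr_ge0 pmulr_lle0 // => r0; apply/eqP.
by rewrite -sqrf_eq0; apply/eqP/le_anti; rewrite r0 sqr_ge0.
Qed.

(** The nearest point [p] of [Q] exists because almost-minimizers of the distance to [h] are Cauchy
    by the parallelogram law. Minimality makes the real inner products of [h - p] with [s] and with
    ['i *: s] vanish, which gives complex orthogonality. *)
Lemma projection F (Q : F -> Prop) (h : F) : closed_sub Q ->
  exists p q, [/\ h = p + q, Q p & forall s, Q s -> ip s q = 0].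
Proof.
case=> Q0 Qlin Qlim; pose D := [set hnrm (h - s) | s in Q].
have Dlb : has_lbound D by exists 0 => _ [s _ <-]; exact: hnrm_ge0.
have Dinf : has_inf D by split=> //; exists (hnrm (h - 0)), 0.
pose d := inf D.
have dQ s : Q s -> d <= hnrm (h - s) by move=> Qs; apply: ge_inf => //; exists s.
have d0 : 0 <= d by apply: lb_le_inf => [|_ [s _ <-]]; [exact: Dinf.1|exact: hnrm_ge0].
have [|e e0|p pP] := @complete_family F (fun t s => Q s /\ hnrm (h - s) < d + t).
- move=> t t0; have [_ [s Qs <-] sd] := inf_adherent t0 Dinf.
  by exists s.
(* For scales [t1], [t2] below 1, the parallelogram law bounds the square of [hnrm (x - y)] by
   [(4 d + 2)(t1 + t2)], hence by [(8 d + 4) e^2 / b], and [b] exceeds [8 d + 4]. *)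
- pose b := 8 * (d + 1) + 1; have b0 : 0 < b by rewrite /b; lra.
  exists (Num.min 1 (e ^+ 2 / b)).
    by rewrite lt_min ltr01 divr_gt0 // exprn_gt0.
  move=> t1 t2 x y + + [Qx xd] [Qy yd]; rewrite !lt_min => /andP[t11 t1b] /andP[t21 t2b].
  have dx := dQ _ Qx; have dy := dQ _ Qy.
  have dm : d <= hnrm (h - (2^-1%:C *: x + 2^-1%:C *: y)).
    by apply: dQ; apply: (Qlin) => //; rewrite -[_ *: y]addr0; exact: Qlin.
  have para : hnrm (x - y) ^+ 2 + 4 * hnrm (h - (2^-1%:C *: x + 2^-1%:C *: y)) ^+ 2 =
     2 * hnrm (h - x) ^+ 2 + 2 * hnrm (h - y) ^+ 2.
    rewrite -!rip_hnrm !(ripDl, ripDr, ripNl, ripNr, ripZl, ripZr).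
    by rewrite (rip_sym y x) (rip_sym x h) (rip_sym y h); field.
  rewrite -(@ltr_pXn2r _ 2) ?nnegrE ?hnrm_ge0 // ?ltW //.
  have e1 : (e ^+ 2 / b) * b = e ^+ 2 by rewrite divfK ?gt_eqF.
  have : 0 < e ^+ 2 / b by rewrite divr_gt0 ?exprn_gt0.
  move: t1b t2b e1; set c := e ^+ 2 / b => t1b t2b e1 c0.
  rewrite /b in e1; nra.
have Qp : Q p by apply: Qlim => e /pP[t [x [_ _ [Qx _] xp]]]; exists x.
have hp : hnrm (h - p) <= d.
  rewrite -subr_le0; apply: (@le0_small _ _ 2) => e /pP[t [x [_ te [_ hx] xp]]].
  have := hnrmB_le x h p; lra.
exists p, (h - p); split=> // [|s Qs]; first by rewrite addrC subrK.
have rQ s' : Q s' -> rip s' (h - p) = 0.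
  move=> Qs'; apply: rip_min => t; apply: le_trans hp _.
  by rewrite -addrA -opprD; apply: dQ; rewrite addrC; exact: Qlin.
have iQs : Q ('i *: s) by rewrite -[_ *: s]addr0; exact: Qlin.
apply: ip_eq0_rip; first exact: rQ.
have := rQ _ iQs.
rewrite /rip ipZr ipZl.
change (complex.Re (conjc 'i * (ip s (h - p) : R[i])) = 0 ->
  complex.Re ('i * (ip s (h - p) : R[i])) = 0).
by case: (ip s (h - p) : R[i]) => u v /=; lra.
Qed.

End Closed.

Section LinearMaps.
Variables (K : pzRingType) (U V : lmodType K) (f : U -> V).
Hypothesis lf : linear f.

Lemma lin0 : f 0 = 0.
Proof. by have := lf (-1) 0 0; rewrite scaler0 addr0 scaleN1r addNr. Qed.
Lemma linD x y : f (x + y) = f x + f y.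
Proof. by have := lf 1 x y; rewrite !scale1r. Qed.
Lemma linZ a x : f (a *: x) = a *: f x.
Proof. by have := lf a x 0; rewrite lin0 !addr0. Qed.
Lemma linB x y : f (x - y) = f x - f y.
Proof. by rewrite linD -scaleN1r linZ scaleN1r. Qed.
Lemma lin_sum I (s : seq I) (g : I -> U) :
  f (\sum_(i <- s) g i) = \sum_(i <- s) f (g i).
Proof.
elim: s => [|i s IH]; first by rewrite !big_nil lin0.
by rewrite !big_cons linD IH.
Qed.

End LinearMaps.

Section ClosedSubspaces.
Variables (R : realType).
Implicit Types (F G : hilb R).

Lemma bounded_op_gt0 F G (T : F -> G) : bounded_op T ->
  linear T /\ exists2 c, 0 < c & forall x, hnrm (T x) <= c * hnrm x.
Proof.
case=> lT [c Tc]; split=> //; exists (`|c| + 1); first by rewrite ltr_wpDl.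
move=> x; rewrite (le_trans (Tc x)) // ler_wpM2r ?hnrm_ge0 //.
by rewrite (le_trans (ler_norm c)) // lerDl.
Qed.

Lemma bounded_op_comp F G (L : hilb R) (S : G -> L) (T : F -> G) :
  bounded_op S -> bounded_op T -> bounded_op (fun x => S (T x)).
Proof.
move=> /bounded_op_gt0[lS [c c0 Sc]] [lT [d Td]]; split=> [a x y|].
  by rewrite lT lS.
exists (c * d) => x; rewrite (le_trans (Sc _)) // -mulrA ler_wpM2l //.
exact: ltW.
Qed.

Lemma closed_sub_preim F G (T : F -> G) (Q : G -> Prop) :
  bounded_op T -> closed_sub Q -> closed_sub (fun x => Q (T x)).
Proof.
move=> /bounded_op_gt0[lT [c c0 Tc]] [Q0 Qlin Qlim]; split=> [|a x y|x xQ].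
- by rewrite (lin0 lT).
- by rewrite lT; exact: Qlin.
- apply: Qlim => e e0; have [y Qy xy] := xQ _ (divr_gt0 e0 c0).
  exists (T y) => //; rewrite -(linB lT) (le_lt_trans (Tc _)) //.
  by rewrite mulrC -ltr_pdivlMr.
Qed.

Lemma closed_sub_eq0 F : closed_sub (fun x : F => x = 0).
Proof.
split=> // [a x y -> ->|x xe]; first by rewrite scaler0 addr0.
apply/hnrm_eq0/le_anti; rewrite hnrm_ge0 andbT.
apply: (@le0_small _ _ 1) => e e0; have [y -> ] := xe _ e0.
by rewrite sub0r hnrmN mul1r => /ltW.
Qed.

Lemma bounded_opB F G (S T : F -> G) : bounded_op S -> bounded_op T ->
  bounded_op (fun x => S x - T x).
Proof.
move=> [lS [c Sc]] [lT [d Td]]; split=> [a x y|].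
  by rewrite lS lT opprD addrACA scalerBr.
exists (c + d) => x; rewrite mulrDl -[S x - T x]/(S x + - T x).
by rewrite (le_trans (hnrmD _ _)) // hnrmN lerD.
Qed.

Lemma closed_sub_eq F G (S T : F -> G) : bounded_op S -> bounded_op T ->
  closed_sub (fun x => S x = T x).
Proof.
move=> bS bT; have := closed_sub_preim (bounded_opB bS bT) (@closed_sub_eq0 G).
rewrite (_ : (fun x => _) = (fun x => S x = T x)) //.
by apply/funext => x; apply/propext; split=> [/eqP|->]; rewrite ?subrr // subr_eq0 => /eqP.
Qed.

Lemma closed_sub_perp F (x : F) : closed_sub (fun y : F => ip x y = 0).
Proof.
split=> [|a y z y0 z0|y yx]; first exact: ip0r.
  by rewrite ipDr ipZr y0 z0 scaler0 addr0.
suff /eq0_normc : normc (ip x y : R[i]) = 0 by [].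
apply/le_anti; apply/andP; split; last by case: (ip x y : R[i]) => ? ?; exact: sqrtr_ge0.
apply: (@le0_small _ _ (2 * hnrm x)) => e /yx[z z0 /ltW zy].
have -> : ip x y = ip x (y - z) by rewrite ipBr z0 subr0.
rewrite (le_trans (normc_ip_le _ _)) // -mulrA ler_wpM2l // ler_wpM2l ?hnrm_ge0 //.
by rewrite hnrmBC.
Qed.

Lemma closed_sub_ominus F (S : set F) : closed_sub (ominus S).
Proof.
split=> [k _|a x y Sx Sy k Sk|x xS k Sk]; first exact: ip0r.
  by rewrite ipDr ipZr Sx // Sy // scaler0 addr0.
apply: (closed_sub_lim (closed_sub_perp k)) => e /xS[y Sy yx].
by exists y => //; exact: Sy.
Qed.

Lemma closed_sub_perpl F (x : F) : closed_sub (fun y : F => ip y x = 0).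
Proof.
have := closed_sub_perp x; congr closed_sub; apply/funext => y.
by apply/propext; split; exact: ip_sym0.
Qed.

(** Preimages of approximations to [y] are as close to each other as the approximations themselves,
    so they converge, and their limit is a preimage of [y]. *)
Lemma closed_sub_range F G (T : F -> G) : isom T ->
  closed_sub (fun y => exists x, T x = y).
Proof.
move=> iT; have lT := isom_linear iT; split=> [|a _ _ [x <-] [y <-]|y yT].
- by exists 0; rewrite (lin0 lT).
- by exists (a *: x + y); rewrite lT.
have [e e0|e e0|x xP] := @complete_family _ F (fun t x => hnrm (T x - y) < t).
- by have [_ [x <-] xy] := yT _ e0; exists x.
- exists (e / 2) => [|a b u v ae be ua vb]; first exact: divr_gt0.
  rewrite -(isom_hnrm _ iT) (linB lT) (le_lt_trans (hnrmB_le y _ _)) //.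
  by rewrite (hnrmBC y); lra.
exists x; apply/eqP; rewrite -subr_eq0; apply/eqP/hnrm_eq0/le_anti.
rewrite hnrm_ge0 andbT; apply: (@le0_small _ _ 2) => e e0.
have [t [u [t0 te uy ux]]] := xP _ e0.
have := hnrmB_le (T u) (T x) y; rewrite -(linB lT) (isom_hnrm _ iT) (hnrmBC x); lra.
Qed.

Lemma range_projection F G (T : F -> G) (y : G) : isom T ->
  exists x q, y = T x + q /\ forall x', ip (T x') q = 0.
Proof.
move=> iT; have [_ [q [-> [x <-] xq]]] := projection y (closed_sub_range iT).
by exists x, q; split=> // x'; apply: xq; exists x'.
Qed.

Definition total_family F I (f : I -> F) := forall x, (forall i, ip (f i) x = 0) -> x = 0.

(** Here [t] is in the double orthogonal complement of the family. Its component off [Q] is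
    orthogonal to each [f i], hence to [t], hence to itself. *)
Lemma perp_perp_ind F I (f : I -> F) (Q : F -> Prop) : closed_sub Q ->
  (forall i, Q (f i)) ->
  forall t, (forall h, (forall i, ip (f i) h = 0) -> ip h t = 0) -> Q t.
Proof.
move=> QC Qf t tf; have [p [q [tE Qp qQ]]] := projection t QC.
have qt : ip q t = 0 by apply: tf => i; apply: qQ.
suff q0 : q = 0 by rewrite tE q0 addr0.
by apply: ip_eq0; move: qt; rewrite tE ipDr (ip_sym0 (qQ _ Qp)) add0r.
Qed.

Lemma total_ind F I (f : I -> F) (Q : F -> Prop) : total_family f -> closed_sub Q ->
  (forall i, Q (f i)) -> forall t, Q t.
Proof.
move=> tf QC Qf t; apply: (perp_perp_ind QC Qf) => h /tf ->.
exact: ip0l.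
Qed.

Lemma total_eq F G I (f : I -> F) (S T : F -> G) : total_family f ->
  bounded_op S -> bounded_op T -> (forall i, S (f i) = T (f i)) ->
  forall x, S x = T x.
Proof. by move=> tf bS bT; apply: total_ind tf _; exact: closed_sub_eq. Qed.

(** The graph of [T] is the smallest closed linear relation through the pairs [(f i, g i)]. Taken as
    an intersection, it requires no separate check that combinations of the [f i] have well-defined
    images: preservation of inner products makes the relation single-valued. *)
Lemma isom_ext F G I (f : I -> F) (g : I -> G) : total_family f ->
  (forall i j, ip (g i) (g j) = ip (f i) (f j)) ->
  exists T : F -> G, isom T /\ forall i, T (f i) = g i.
Proof.
move=> tf fg.
pose closed_rel (K : F -> G -> Prop) := [/\ K 0 0,
  forall a x y x' y', K x y -> K x' y' -> K (a *: x + x') (a *: y + y') &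
  forall x y, (forall e, 0 < e -> exists x' y',
     [/\ K x' y', hnrm (x' - x) < e & hnrm (y' - y) < e]) -> K x y].
pose graph x y := forall K, closed_rel K -> (forall i, K (f i) (g i)) -> K x y.
have graphC : closed_rel graph.
  split=> [K [] //|a x y x' y' xy xy' K KC Kfg|x y xy K KC Kfg].
    by have [_ + _] := KC; apply; [exact: xy|exact: xy'].
  have [_ _] := KC; apply=> e /xy[x' [y' [xy' xx yy]]].
  by exists x', y'; split=> //; exact: xy'.
(* Preserving the inner product with one fixed pair is itself a closed relation, so it passes from
   the generators to the whole graph; [graph_ip] does this in one variable and then in the other. *)
have relip (u : F) (v : G) : closed_rel (fun x y => ip v y = ip u x).
  split=> [|a x y x' y' xy xy'|x y xy]; first by rewrite !ip0r.
    by rewrite !ipDr !ipZr xy xy'.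
  apply/eqP; rewrite -subr_eq0; apply/eqP.
  suff /eq0_normc : normc (ip v y - ip u x : R[i]) = 0 by [].
  apply/le_anti/andP; split; last by case: (_ - _ : R[i]) => ? ?; exact: sqrtr_ge0.
  apply: (@le0_small _ _ (2 * (hnrm u + hnrm v))) => e /xy[x' [y' [xy' xx yy]]].
  have -> : ip v y - ip u x = ip u (x' - x) - ip v (y' - y).
    by rewrite !ipBr xy' opprB [RHS]addrC subrKA.
  apply: le_trans (le_normcD _ _) _; rewrite normcN.
  apply: le_trans (lerD (normc_ip_le _ _) (normc_ip_le _ _)) _.
  have := hnrm_ge0 u; have := hnrm_ge0 v; nra.
have graph_ip x y x' y' : graph x y -> graph x' y' -> ip y y' = ip x x'.
  move=> xy xy'.
  have gi i : ip (g i) y' = ip (f i) x' by apply: (xy' _ (relip (f i) (g i))).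
  rewrite -[LHS]ip_star -[RHS]ip_star; congr cstr.
  apply: (xy _ (relip x' y')) => i.
  by rewrite -[LHS]ip_star -[RHS]ip_star gi.
have [g0 glin glim] := graphC.
have graphB x y x' y' : graph x y -> graph x' y' -> graph (x' - x) (y' - y).
  move=> xy xy'; have := glin (-1) _ _ _ _ xy xy'.
  by rewrite !scaleN1r !(addrC (- _)).
have graph_nrm x y : graph x y -> hnrm y = hnrm x.
  by move=> xy; rewrite /hnrm (graph_ip _ _ _ _ xy xy).
(* The domain is closed: images of points converging to [x] are Cauchy because the graph preserves
   norms, and the graph contains the limit pair. *)
have graph_total : forall x, exists y, graph x y.
  apply: (total_ind tf) => [|i]; last by exists (g i) => K.
  split=> [|a x x' [y xy] [y' xy']|x xQ]; first by exists 0.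
    by exists (a *: y + y'); exact: glin.
  have [e e0|e e0|y yP] := @complete_family _ G
      (fun t y => exists2 x', graph x' y & hnrm (x' - x) < t).
  - by have [x' [y xy] xe] := xQ _ e0; exists y, x'.
  - exists (e / 2) => [|a b y y' ae be [z zy zx] [z' zy' zx']]; first exact: divr_gt0.
    rewrite (graph_nrm _ _ (graphB _ _ _ _ zy' zy)) (le_lt_trans (hnrmB_le x _ _)) //.
    by rewrite (hnrmBC x); lra.
  exists y; apply: glim => e /yP[t [y' [t0 te [x' xy' xx] yy]]].
  by exists x', y'; split=> //; exact: lt_trans te.
have /choice[T Tg] := graph_total.
have iT : isom T by move=> x y; exact: graph_ip.
exists T; split=> // i; apply/eqP; rewrite -subr_eq0; apply/eqP/hnrm_eq0.
have fgi : graph (f i) (g i) by move=> K.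
by rewrite (graph_nrm _ _ (graphB _ _ _ _ fgi (Tg (f i)))) subrr hnrm0.
Qed.

End ClosedSubspaces.

(** * Tensor products *)

Section TheOp.
Variables (R : realType).
Implicit Types (F G : hilb R).

Lemma the_opP (B B' : cstar R) (F : hmod B) (G : hmod B') (P : (F -> G) -> Prop) :
  (exists T, bounded_op T /\ P T) -> bounded_op (the_op P) /\ P (the_op P).
Proof. by move=> exT; exact: (xgetPex _ exT). Qed.

(** The chosen operator is a priori only bounded; it agrees with the isometric extension on a total
    family, hence everywhere. *)
Lemma the_op_isom F G I (f : I -> F) (g : I -> G) (P : (F -> G) -> Prop) :
  total_family f -> (forall i j, ip (g i) (g j) = ip (f i) (f j)) ->
  (forall T, P T <-> forall i, T (f i) = g i) ->
  isom (the_op P) /\ P (the_op P).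
Proof.
move=> tf fg PE; have [T [iT Tf]] := isom_ext tf fg.
have bT := isom_bounded iT.
have [|bP PP] := the_opP (P := P); first by exists T; split=> //; apply/PE.
split=> //; rewrite (_ : the_op P = T) //; apply/funext.
by apply: (total_eq tf) => // i; rewrite Tf; move/PE: PP.
Qed.

(** The range of [T] is closed, so [y] splits along it; the adjoint returns the preimage of the
    component in the range. *)
Lemma adj_isom F G (T : F -> G) : isom T ->
  forall x y, ip (T x) y = ip x (adj T y).
Proof.
move=> iT; have /choice[S SP] : forall y, exists x, forall x', ip (T x') y = ip x' x.
  move=> y; have [x [q [-> xq]]] := range_projection y iT.
  by exists x => x'; rewrite ipDr iT xq addr0.
have [|//] := @the_opP _ _ G F (fun S => forall x y, ip (T x) y = ip x (S y)).
exists S; split=> //; split=> [a y y'|].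
  by apply: ip_inj => x; rewrite ipDr ipZr -!SP ipDr ipZr.
exists 1 => y; rewrite mul1r.
have : hnrm (S y) * hnrm (S y) <= hnrm y * hnrm (S y).
  rewrite -expr2 -rip_hnrm /rip -SP -/(rip _ _) (le_trans (rip_le _ _)) //.
  by rewrite (isom_hnrm _ iT) mulrC.
have := hnrm_ge0 (S y); rewrite le0r => /orP[/eqP -> _|S0]; first exact: hnrm_ge0.
by rewrite ler_pM2r.
Qed.

Lemma adj_isomK F G (T : F -> G) : isom T -> cancel T (adj T).
Proof. by move=> iT x; apply: ip_inj => z; rewrite -adj_isom // iT. Qed.

Lemma pullK (B : cstar R) (F G : hmod B) (j : G -> F) : isom j -> cancel j (pull j).
Proof.
move=> ij y; apply: (isom_inj ij).
by apply: (@xgetPex _ 0 [set z | j z = j y]); exists y.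
Qed.

Lemma pullP (B : cstar R) (F G : hmod B) (j : G -> F) x :
  (exists y, j y = x) -> j (pull j x) = x.
Proof. exact: xgetPex. Qed.

End TheOp.

Section Correspondences.
Variables (R : realType).
Notation Cx := (complex_cstar R).

Lemma lact_bounded (B : cstar R) (F : corr B Cx) (b : B) : bounded_op (@lact _ _ _ F b).
Proof.
split; first exact: lact_linr.
by exists (cnrm b) => x; exact: lact_nrm.
Qed.

Definition intertwines (B D : cstar R) (F G : corr B D) (T : F -> G) :=
  forall b x, T (lact b x) = lact b (T x).

(** The inner product of a tensor product involves the left action of the right factor, so
    [tmap f g] is isometric only when [g] also intertwines. *)
Definition mor (B : cstar R) (F G : corr B Cx) (T : F -> G) :=
  isom T /\ intertwines T.

Lemma mor_comp (B : cstar R) (F G K : corr B Cx) (S : G -> K) (T : F -> G) :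
  mor S -> mor T -> mor (fun x => S (T x)).
Proof.
move=> [iS aS] [iT aT]; split=> [|b x]; first exact: isom_comp iS iT.
by rewrite aT aS.
Qed.

Lemma mor_id (B : cstar R) (F : corr B Cx) : mor (@id F).
Proof. by []. Qed.

Lemma intertwines_total (B : cstar R) (F G : corr B Cx) I (f : I -> F) (T : F -> G) :
  total_family f -> isom T -> (forall b i, T (lact b (f i)) = lact b (T (f i))) ->
  intertwines T.
Proof.
move=> tf /isom_bounded bT fT b x; move: x.
apply: (total_eq (S := fun x => T (lact b x)) (T := fun x => lact b (T x)) tf).
- exact: (bounded_op_comp bT (lact_bounded F b)).
- exact: (bounded_op_comp (lact_bounded G b) bT).
- by move=> i; exact: fT.
Qed.

(** Over a general C*-algebra a trivial orthogonal complement does not imply density, hence this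
    stronger notion for left tensor factors. The sums carry no coefficients, the families in use
    being stable under scalars. *)
Definition dense_family (B D : cstar R) (F : corr B D) I (f : I -> F) :=
  forall z (e : R), 0 < e -> exists s : seq I, hnrm (z - \sum_(i <- s) f i) < e.

Lemma dense_total (B : cstar R) (F : corr B Cx) I (f : I -> F) : dense_family f -> total_family f.
Proof.
move=> df x fx; apply: hnrm_eq0; apply/le_anti; rewrite hnrm_ge0 andbT.
rewrite leNgt; apply/negP => x0; have [s sx] := df x _ x0.
have : rip x x <= hnrm (x - \sum_(i <- s) f i) * hnrm x.
  rewrite (_ : rip x x = rip (x - \sum_(i <- s) f i) x) ?rip_le //.
  by rewrite /rip ipBl ip_suml big1 ?subr0.
by rewrite rip_hnrm expr2 ler_pM2r // leNgt sx.
Qed.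

End Correspondences.

Section TensorOps.
Variables (R : realType) (M : models R).
Notation Cx := (complex_cstar R).

Section General.
Variables (A B D : cstar R) (E : corr A B) (F : corr B D).

Lemma ten_ip x y x' y' :
  ip (ten M (E := E) (F := F) x y) (ten M x' y') = ip y (lact (ip x x') y').
Proof. exact: tmul_ip. Qed.
Lemma ten_lact a x y : lact a (ten M (E := E) (F := F) x y) = ten M (lact a x) y.
Proof. exact: tmul_lact. Qed.
Lemma ten_linl y : linear (fun x => ten M (E := E) (F := F) x y).
Proof. exact: tmul_linl. Qed.
Lemma ten_linr x : linear (ten M (E := E) (F := F) x).
Proof. exact: tmul_linr. Qed.
Lemma ten_dense : dense_family (fun p => ten M (E := E) (F := F) p.1 p.2).
Proof. by move=> z e e0; exact: tmul_dense. Qed.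

End General.

Section Hilbert.
Variables (A B : cstar R) (E : corr A B).
Implicit Types (F G : corr B Cx).

Lemma ten_total F : total_family (fun p => ten M (E := E) (F := F) p.1 p.2).
Proof. by apply: dense_total; exact: ten_dense. Qed.

Lemma ten_hnrm F (x : E) (y : F) : hnrm (ten M x y) <= hnrm x * hnrm y.
Proof.
rewrite -(@ler_pXn2r _ 2) ?nnegrE ?mulr_ge0 ?hnrm_ge0 //.
rewrite -rip_hnrm /rip ten_ip -/(rip _ _) (le_trans (rip_le _ _)) //.
rewrite exprMn hnrm_sqr mulrC expr2 mulrA ler_wpM2r ?hnrm_ge0 //.
exact: lact_nrm.
Qed.

Lemma ten_bounded F (x : E) : bounded_op (ten M (F := F) x).
Proof.
split; first exact: ten_linr.
by exists (hnrm x) => y; exact: ten_hnrm.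
Qed.

Lemma ten_total_r F J (g : J -> F) : total_family g ->
  total_family (fun p => ten M (E := E) p.1 (g p.2)).
Proof.
move=> tg z gz; apply: ten_total => -[x y]; apply: ip_sym0; move: y.
apply: (total_ind tg).
  exact: closed_sub_preim (ten_bounded F x) (closed_sub_perp z).
by move=> j; apply: ip_sym0; exact: (gz (x, j)).
Qed.

Lemma ten_total_l F J (g : J -> E) : dense_family g ->
  total_family (fun p => ten M (F := F) (g p.1) p.2).
Proof.
move=> dg z gz; apply: ten_total => -[x y].
apply: ip_sym0; apply: (closed_sub_lim (closed_sub_perp z)) => e e0.
have y1 : 0 < hnrm y + 1 by rewrite ltr_wpDl ?hnrm_ge0.
have [s sx] := dg x _ (divr_gt0 e0 y1).
exists (\sum_(j <- s) ten M (g j) y).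
  by apply: ip_sym0; rewrite ip_suml big1 // => j _; exact: (gz (j, y)).
rewrite hnrmBC -(lin_sum (ten_linl y)) -(linB (ten_linl y)).
rewrite (le_lt_trans (ten_hnrm _ _)) // (le_lt_trans (y := e / (hnrm y + 1) * hnrm y)) //.
  by rewrite ler_wpM2r ?hnrm_ge0 // ltW.
by rewrite mulrAC ltr_pdivrMr // ltr_pM2l // ltrDl.
Qed.

End Hilbert.
End TensorOps.

Section TensorMaps.
Variables (R : realType) (M : models R).
Notation Cx := (complex_cstar R).

Lemma textend_isom (A B : cstar R) (E : corr A B) (F : corr B Cx) (G : hilb R)
    (f : E -> F -> G) :
  (forall x y x' y', ip (f x y) (f x' y') = ip y (lact (ip x x') y')) ->
  isom (textend (M := M) f) /\ forall x y, textend (M := M) f (ten M x y) = f x y.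
Proof.
move=> fE; apply: (@the_op_isom _ _ _ _ _ (fun p : E * F => f p.1 p.2)).
- exact: ten_total.
- by move=> [x y] [x' y']; rewrite ten_ip.
- by move=> T; split=> [Tf [x y]|Tf x y]; [exact: Tf|exact: (Tf (x, y))].
Qed.

Section Tmap.
Variables (A B : cstar R) (E E' : corr A B) (F F' : corr B Cx).
Variables (f : E -> E') (g : F -> F').
Hypotheses (fi : isom f) (gm : mor g).

Lemma tmap_spec : isom (tmap (M := M) f g) /\
  forall x y, tmap (M := M) f g (ten M x y) = ten M (f x) (g y).
Proof.
by apply: textend_isom => x y x' y'; rewrite ten_ip fi -gm.2 gm.1.
Qed.

Lemma tmap_isom : isom (tmap (M := M) f g). Proof. by case: tmap_spec. Qed.
Lemma tmapE x y : tmap (M := M) f g (ten M x y) = ten M (f x) (g y).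
Proof. by case: tmap_spec. Qed.
Lemma tmap_mor : intertwines f -> mor (tmap (M := M) f g).
Proof.
move=> fl; split; first exact: tmap_isom.
apply: (intertwines_total (@ten_total _ M _ _ E F)) => [|b [x y]].
  exact: tmap_isom.
by rewrite /= ten_lact !tmapE fl ten_lact.
Qed.

End Tmap.

Lemma tmap_id_mor (A B : cstar R) (E : corr A B) (F F' : corr B Cx) (g : F -> F') :
  mor g -> mor (tmap (M := M) (@id E) g).
Proof. by move=> gm; apply: tmap_mor. Qed.

Lemma tmap_idE (A B : cstar R) (E : corr A B) (F F' : corr B Cx) (g : F -> F')
  (gm : mor g) x y : tmap (M := M) (@id E) g (ten M x y) = ten M x (g y).
Proof. exact: tmapE. Qed.

Lemma tmap_id_comp (A B : cstar R) (E : corr A B) (F F' F'' : corr B Cx)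
    (h : F' -> F'') (g : F -> F') (k : F -> F'') (hm : mor h) (gm : mor g) :
  (forall x, k x = h (g x)) -> forall x,
  tmap (M := M) (@id E) h (tmap (M := M) (@id E) g x) = tmap (M := M) (@id E) k x.
Proof.
move=> kE; have km : mor k.
  by rewrite (_ : k = fun x => h (g x)) ?boolp.funeqE //; exact: mor_comp.
have hb := (isom_bounded (tmap_id_mor E hm).1).
have gb := (isom_bounded (tmap_id_mor E gm).1).
apply: (total_eq (@ten_total _ M _ _ E F) (bounded_op_comp hb gb)).
  exact: (isom_bounded (tmap_id_mor E km).1).
by move=> [x y]; rewrite /= !tmap_idE // kE.
Qed.

Lemma mor_inj (B : cstar R) (F G : corr B Cx) (T : F -> G) : mor T -> injective T.
Proof. by move=> [iT _]; exact: isom_inj. Qed.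

Section Assoc.
Variables (A B D : cstar R) (X : corr A B) (Y : corr B D) (Z : corr D Cx).

Lemma ten_total_ll : total_family (fun p : (X * Y) * Z => ten M (ten M p.1.1 p.1.2) p.2).
Proof. exact: (ten_total_l (@ten_dense _ M _ _ _ X Y)). Qed.

Lemma ten_total_rr : total_family (fun p : X * (Y * Z) => ten M p.1 (ten M p.2.1 p.2.2)).
Proof. exact: (@ten_total_r _ M _ _ X _ _ _ (@ten_total _ M _ _ Y Z)). Qed.

Lemma tassoc_spec : isom (@tassoc _ M _ _ _ _ X Y Z) /\
  forall x y z, @tassoc _ M _ _ _ _ X Y Z (ten M (ten M x y) z) = ten M x (ten M y z).
Proof.
apply: (the_op_isom (g := fun p : (X * Y) * Z => ten M p.1.1 (ten M p.1.2 p.2)) ten_total_ll).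
- by move=> [[x y] z] [[x' y'] z'] /=; rewrite !(ten_ip, ten_lact).
- by move=> T; split=> [Tf [[x y] z]|Tf x y z]; [exact: Tf|exact: (Tf (x, y, z))].
Qed.

Lemma tassocV_spec : isom (@tassocV _ M _ _ _ _ X Y Z) /\
  forall x y z, @tassocV _ M _ _ _ _ X Y Z (ten M x (ten M y z)) = ten M (ten M x y) z.
Proof.
apply: (the_op_isom (g := fun p : X * (Y * Z) => ten M (ten M p.1 p.2.1) p.2.2) ten_total_rr).
- by move=> [x [y z]] [x' [y' z']] /=; rewrite !(ten_ip, ten_lact).
- by move=> T; split=> [Tf [x [y z]]|Tf x y z]; [exact: Tf|exact: (Tf (x, (y, z)))].
Qed.

Definition tassoc_isom := tassoc_spec.1.
Definition tassocE := tassoc_spec.2.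
Definition tassocV_isom := tassocV_spec.1.
Definition tassocVE := tassocV_spec.2.

Lemma tassoc_mor : mor (@tassoc _ M _ _ _ _ X Y Z).
Proof.
split; first exact: tassoc_isom.
apply: (intertwines_total ten_total_ll tassoc_isom) => b [[x y] z].
by rewrite /= !ten_lact !tassocE !ten_lact.
Qed.

Lemma tassocVK x : @tassoc _ M _ _ _ _ X Y Z (tassocV x) = x.
Proof.
move: x; apply: (total_eq (T := id) ten_total_rr).
- exact: bounded_op_comp (isom_bounded tassoc_isom) (isom_bounded tassocV_isom).
- exact: (@isom_bounded _ _ _ _ id).
- by move=> [x [y z]] /=; rewrite tassocVE tassocE.
Qed.

End Assoc.

(** If [H] is the range of [g] plus [S], orthogonally, then the complement of [E (x) S] is
    [E (x) g(G)]: the component of [z] off the range of [I (x) g] is orthogonal to both [E (x) g(G)]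
    and [E (x) S]. *)
Lemma tmap_id_range (B : cstar R) (A : cstar R) (E : corr A B) (G H : corr B Cx)
    (g : G -> H) (S : set H) : mor g ->
  (forall y t, S t -> ip t (g y) = 0) ->
  (forall h, exists y t, S t /\ h = g y + t) ->
  forall z : tprod M E H, (forall xi t, S t -> ip (ten M xi t) z = 0) ->
  exists u, z = tmap (M := M) (@id E) g u.
Proof.
move=> gm Sg gS z Sz; have im := (tmap_id_mor E gm).1.
have [u [q [zE uq]]] := range_projection z im.
exists u; suff q0 : q = 0 by rewrite zE q0 addr0.
apply: (@ten_total _ M _ _ E H) => -[x h].
have [y [t [St ->]]] := gS h.
rewrite (linD (ten_linr M x)) ipDl -[ten M x (g y)](tmap_idE gm) uq add0r.
have -> : q = z - tmap (M := M) (@id E) g u by rewrite zE addrAC subrr add0r.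
rewrite ipBr Sz // sub0r; apply/eqP; rewrite oppr_eq0; apply/eqP.
move: u {zE}; apply: (total_ind (@ten_total _ M _ _ E G)).
  exact: closed_sub_preim (isom_bounded im) (closed_sub_perp _).
by move=> [x' y']; rewrite tmap_idE // ten_ip -gm.2 Sg.
Qed.

Lemma tmap_orth_decomp (A B : cstar R) (E : corr A B) (F F1 F2 : corr B Cx)
    (i : F1 -> F) (j : F2 -> F) : mor i -> mor j ->
  (forall x y, ip (i x) (j y) = 0) -> (forall z, exists x y, z = i x + j y) ->
  orth_decomp (tmap (M := M) (@id E) i) (tmap (M := M) (@id E) j).
Proof.
move=> im jm ij0 ij; have Im := (tmap_id_mor E im).1; have Jm := (tmap_id_mor E jm).1.
split; [by split=> //; exact: isom_bounded..| |].
  move=> x y; move: x; apply: (total_ind (@ten_total _ M _ _ E F1)).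
    exact: closed_sub_preim (isom_bounded Im) (closed_sub_perpl _).
  move=> [x1 y1]; move: y; apply: (total_ind (@ten_total _ M _ _ E F2)).
    exact: closed_sub_preim (isom_bounded Jm) (closed_sub_perp _).
  by move=> [x2 y2]; rewrite !tmap_idE // ten_ip -jm.2 ij0.
move=> z; have [y [q [zE yq]]] := range_projection z Jm.
suff [x qE] : exists x, q = tmap (M := M) (@id E) i x.
  by exists x, y; rewrite zE qE addrC.
apply: (tmap_id_range (S := range j) im) => [x _ [y' _ <-]|h|xi _ [y' _ <-]].
- exact: ip_sym0.
- by have [x [y' ->]] := ij h; exists x, (j y'); split=> //; exists y'.
- by rewrite -(tmap_idE jm).
Qed.

End TensorMaps.

(** * Representations *)

Section Subspaces.
Variables (R : realType) (A : cstar R) (H : rep A).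
Notation Cx := (complex_cstar R).

(** The Hilbert-space form of nondegeneracy; it determines the vacuum embedding, which is specified
    only on vectors [lact a k]. *)
Definition lact_total (K : rep A) := total_family (fun p : A * K => lact p.1 p.2).

Lemma nondegenerate_total (K : rep A) : Defs.nondegenerate K -> lact_total K.
Proof. by move=> ndK; apply: dense_total => z e e0; exact: ndK. Qed.

Lemma closed_invariant_sub (P : set H) : closed_invariant P -> closed_sub P.
Proof. by case=> P0 Plin _ _ Pcl; split. Qed.

Lemma lact0l (B D : cstar R) (F : corr B D) (x : F) : lact 0 x = 0.
Proof. exact: lin0 (lact_linl x). Qed.

Lemma closed_invariant_ominus (S : set H) :
  (forall a k, S k -> S (lact a k)) -> closed_invariant (ominus S).
Proof.
move=> Sl; have [S0 Slin Scl] := closed_sub_ominus S; split=> //.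
- by move=> x b xS k Sk; rewrite ip_ract xS // (lin0 (cmul_linl b)).
- by move=> a x xS k Sk; rewrite -{1}(cstrK a) -lact_adj xS //; exact: Sl.
Qed.

Lemma isom_ract (F G : hilb R) (T : F -> G) : isom T ->
  forall x b, T (ract x b) = ract (T x) b.
Proof.
move=> iT x b; apply/eqP; rewrite -subr_eq0; apply/eqP/ip_eq0.
set d := _ - _; have Td z : ip (T z) d = 0.
  by rewrite ipBr ip_ract !iT ip_ract subrr.
by rewrite {2}/d ipBr ip_ract (ip_sym0 (Td _)) (ip_sym0 (Td _)) (lin0 (cmul_linl b)) subrr.
Qed.

Lemma closed_invariant_range (F : rep A) (T : F -> H) : mor T ->
  closed_invariant (range T).
Proof.
move=> [iT lT]; have rE : (fun y => exists x, T x = y) = range T.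
  by apply/funext => y; apply/propext; split=> [] [x]; [|move=> _]; exists x.
have := closed_sub_range iT; rewrite rE => -[T0 Tlin Tcl]; split=> //.
- by move=> _ b [x _ <-]; exists (ract x b); rewrite ?(isom_ract iT).
- by move=> a _ [x _ <-]; exists (lact a x); rewrite ?lT.
Qed.

Section ClosedInvariant.
Variables (P : set H) (Pci : closed_invariant P).

Lemma sub_in_mem (x : sub P) : P (sub_in x).
Proof. by have /(_ P Pci) := @sub_eltP _ _ _ _ P x; apply. Qed.

Lemma sub_in_surj h : P h -> exists x : sub P, sub_in x = h.
Proof.
move=> Ph; have cPh : cspan P h by move=> Q _; apply.
by exists (sub_elt cPh).
Qed.

Lemma sub_in_mor : mor (@sub_in _ _ _ H P).
Proof. by []. Qed.

Lemma sub_decomp h : exists (x : sub P) q, ominus P q /\ h = sub_in x + q.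
Proof.
have [p [q [-> /sub_in_surj[x <-] qP]]] := projection h (closed_invariant_sub Pci).
by exists x, q.
Qed.

(** Let [x] in [P] be orthogonal to all [lact a p]. For [q] orthogonal to [P], the product of
    [lact a q] with [x] is that of [q] with [lact (cstr a) x], which stays in [P]; so [x] is
    orthogonal to every [lact a h]. *)
Lemma lact_total_sub : lact_total H -> lact_total (sub P).
Proof.
move=> tH x xl; apply: (isom_inj sub_in_mor.1); rewrite (lin0 (isom_linear sub_in_mor.1)).
apply: tH => -[a h]; have [p [q [qP ->]]] := sub_decomp h.
change (ip (lact a (sub_in p + q)) (sub_in x) = 0).
rewrite (linD (lact_linr a)) ipDl -(sub_in_mor.2 a p) sub_in_mor.1 (xl (a, p)) add0r.
by rewrite lact_adj; apply: ip_sym0; rewrite -sub_in_mor.2 qP //; exact: sub_in_mem.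
Qed.

End ClosedInvariant.

Lemma incl_spec (P Q : set H) : closed_invariant P -> closed_invariant Q ->
  P `<=` Q -> mor (@incl _ _ _ H P Q) /\ forall x, sub_in (incl P Q x) = sub_in x.
Proof.
move=> Pci Qci PQ; have inE x : sub_in (incl P Q x) = sub_in x.
  apply: (pullP (j := @sub_in _ _ _ H Q)); apply: sub_in_surj => //.
  by apply: PQ; exact: (sub_in_mem Pci).
split=> //; split=> [x y|a x].
  by rewrite -(sub_in_mor Q).1 !inE (sub_in_mor P).1.
by apply: (isom_inj (sub_in_mor Q).1); rewrite inE !(sub_in_mor _).2 inE.
Qed.

End Subspaces.

Section Representation.
Variables (R : realType) (M : models R) (A : cstar R).
Variables (E : corr A A) (H : rep A) (V : E -> H -> H).

(** Covariance is given for both actions at once and there may be no unit to separate them. The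
    right action is split off by isometry, as the defect is orthogonal to itself; the left identity
    then holds on vectors [lact a k], which are total. *)
Lemma covrep_lact : covrep V -> isometric_rep V ->
  forall b xi h, V (lact b xi) h = lact b (V xi h).
Proof.
move=> cV iV b xi h; have tH := nondegenerate_total (cov_nondegenerate cV).
have bV xi' : bounded_op (V xi') by exact: cov_bounded.
have Vract xi' a k : V (ract xi' a) k = V xi' (lact a k).
  apply/eqP; rewrite -subr_eq0; apply/eqP/ip_eq0.
  set d := _ - _; have Vd eta l : ip (V eta l) d = 0.
    by rewrite ipBr !iV ip_ract lactM subrr.
  by rewrite {2}/d ipBr (ip_sym0 (Vd _ _)) (ip_sym0 (Vd _ _)) subrr.
move: h; apply: (total_eq (S := V (lact b xi)) (T := fun h => lact b (V xi h)) tH) => //.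
  exact: bounded_op_comp (lact_bounded _ _) _.
by move=> [a k]; rewrite /= -Vract -lact_ract cov_bimodule.
Qed.

Hypothesis V_iso : isometric_rep V.
Hypothesis V_lact : forall b xi h, V (lact b xi) h = lact b (V xi h).

Lemma tilde_spec : isom (tilde M V) /\ forall xi h, tilde M V (ten M xi h) = V xi h.
Proof. by apply: textend_isom => x h y k; rewrite V_iso. Qed.

Lemma tildeE xi h : tilde M V (ten M xi h) = V xi h.
Proof. by case: tilde_spec. Qed.

Lemma tilde_mor : mor (tilde M V).
Proof.
have [it tE] := tilde_spec; split=> //.
apply: (intertwines_total (@ten_total _ M _ _ E H) it) => b [xi h].
by rewrite /= ten_lact !tE V_lact.
Qed.

Lemma rep_bounded xi : bounded_op (V xi).
Proof.
have -> : V xi = fun h => tilde M V (ten M xi h).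
  by apply/funext => h; rewrite tildeE.
exact: bounded_op_comp (isom_bounded tilde_spec.1) (ten_bounded _ _ _).
Qed.

Lemma tilde_iter_mor n : mor (@tilde_iter _ M _ _ _ V n).
Proof.
elim: n => [|n IH]; last first.
  exact: (mor_comp tilde_mor (mor_comp (tmap_id_mor M E IH) (tassoc_mor M E (tpower M E n) H))).
have [it tE] : isom (@tilde_iter _ M _ _ _ V 0) /\ forall (a : regular A) (h : H),
    @tilde_iter _ M _ _ _ V 0 (ten M a h) = lact (a : A) h.
  by apply: textend_isom => a h b k; rewrite /= lact_adj lactM.
split=> //; apply: (intertwines_total (@ten_total _ M _ _ (regular A) H) it) => b [a h].
change (tilde_iter V (n := 0) (lact b (ten M a h)) =
  lact b (tilde_iter V (n := 0) (ten M a h))).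
by rewrite ten_lact !tE -lactM.
Qed.

Lemma tilde_iter0E (a : regular A) h :
  tilde_iter (M := M) V (n := 0) (ten M a h) = lact (a : A) h.
Proof.
have [_] : isom (@tilde_iter _ M _ _ _ V 0) /\ forall (a : regular A) (h : H),
    @tilde_iter _ M _ _ _ V 0 (ten M a h) = lact (a : A) h; last by apply.
by apply: textend_isom => b k c l; rewrite /= lact_adj lactM.
Qed.

Lemma tilde_iterSE n xi (eta : tpower M E n) h :
  tilde_iter V (n := n.+1) (ten M (ten M xi eta) h) =
  V xi (tilde_iter V (ten M eta h)).
Proof.
by rewrite /= tassocE (tmap_idE M (tilde_iter_mor n)) tildeE.
Qed.

Lemma wset_ci : closed_invariant (wset M V).
Proof.
apply: closed_invariant_ominus => a _ [z _ <-].
by exists (lact a z) => //; exact: tilde_mor.2.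
Qed.

Lemma wset_decomp h : exists z q, wset M V q /\ h = tilde M V z + q.
Proof.
have [z [q [-> zq]]] := range_projection h tilde_mor.1.
by exists z, q; split=> // _ [z' _ <-].
Qed.

End Representation.

(** * Fock space and Wold decomposition *)

Section FockSpace.
Variables (R : realType) (M : models R) (A : cstar R) (E : corr A A) (K : rep A).

Definition homogeneous := {n & tpower M E n}.

Lemma fock_dense : dense_family (fun p : homogeneous => fock_in (projT2 p)).
Proof.
move=> z e e0; have [N [x xz]] := din_dense z e0.
exists (map (fun n : 'I_N => existT _ (nat_of_ord n) (x n) : homogeneous) (index_enum 'I_N)).
by rewrite big_map.
Qed.

Lemma fock_total :
  total_family (fun p : homogeneous * K => ten M (fock_in (projT2 p.1)) p.2).
Proof. exact: (ten_total_l fock_dense). Qed.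

Lemma fock_in_ip n (x y : tpower M E n) : ip (fock_in x) (fock_in y) = ip x y.
Proof. exact: din_ip. Qed.

Lemma fock_in_orth m n (x : tpower M E m) (y : tpower M E n) : m <> n ->
  ip (fock_in x) (fock_in y) = 0.
Proof. exact: din_orth. Qed.

Lemma fock_in_lact n a (x : tpower M E n) : lact a (fock_in x) = fock_in (lact a x).
Proof. exact: din_lact. Qed.

(** Creation by a single [xi] need not be isometric, so [isom_ext] does not apply to it directly.
    The operator on [E (x) F(E) (x) K] is isometric, and [creation xi] is its composite with
    tensoring by [xi]. *)
Lemma creation_tilde_ex : exists S : tprod M E (tprod M (fock M E) K) -> tprod M (fock M E) K,
  isom S /\ forall xi n (eta : tpower M E n) k,
    S (ten M xi (ten M (fock_in eta) k)) = ten M (fock_in (n := n.+1) (ten M xi eta)) k.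
Proof.
have [|S [iS SE]] := isom_ext
  (g := fun p : E * (homogeneous * K) =>
     ten M (fock_in (n := (projT1 p.2.1).+1) (ten M p.1 (projT2 p.2.1))) p.2.2)
  (@ten_total_r _ M _ _ E _ _ _ fock_total).
  move=> [xi [[n eta] k]] [xi' [[m eta'] k']].
  rewrite /= !(ten_ip, ten_lact) fock_in_lact.
  have [nm|/eqP nm] := eqVneq n m; first by subst m; rewrite !fock_in_ip ten_ip.
  by rewrite !fock_in_orth ?lact0l //; case.
exists S; split=> // xi n eta k.
exact: (SE (xi, (existT _ n eta, k))).
Qed.

Lemma creation_ex : exists S : tprod M E (tprod M (fock M E) K) -> tprod M (fock M E) K,
  isom S /\ forall xi x, creation M E K xi x = S (ten M xi x).
Proof.
have [S [iS SE]] := creation_tilde_ex; exists S; split=> // xi.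
have bS := bounded_op_comp (isom_bounded iS) (ten_bounded M (tprod M (fock M E) K) xi).
have [|bC CE] := @the_opP _ _ _ (tprod M (fock M E) K) (tprod M (fock M E) K)
  (fun T => forall n (eta : tpower M E n) k, T (ten M (fock_in eta) k) =
    ten M (fock_in (n := n.+1) (ten M xi eta)) k).
  by exists (fun x => S (ten M xi x)).
apply: (total_eq fock_total bC bS) => -[[n eta] k].
by rewrite CE SE.
Qed.

Lemma creation_isometric : isometric_rep (creation M E K).
Proof.
by have [S [iS CE]] := creation_ex => eta xi h k; rewrite !CE iS ten_ip.
Qed.

Lemma creationE xi n (eta : tpower M E n) k :
  creation M E K xi (ten M (fock_in eta) k) =
  ten M (fock_in (n := n.+1) (ten M xi eta)) k.
Proof.
have [S [iS SE]] := creation_tilde_ex.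
have bS := bounded_op_comp (isom_bounded iS) (ten_bounded M (tprod M (fock M E) K) xi).
have [|_] := @the_opP _ _ _ (tprod M (fock M E) K) (tprod M (fock M E) K)
  (fun T => forall n (eta : tpower M E n) k, T (ten M (fock_in eta) k) =
    ten M (fock_in (n := n.+1) (ten M xi eta)) k); last exact.
by exists (fun x => S (ten M xi x)).
Qed.

Hypothesis K_total : lact_total K.

Lemma vacuum_spec : isom (vacuum M E K) /\
  forall (a : A) k, vacuum M E K (lact a k) = ten M (fock_in (n := 0) a) k.
Proof.
apply: (the_op_isom
  (g := fun p : A * K => ten M (fock_in (E := E) (n := 0) p.1) p.2) K_total).
- move=> [a k] [b l] /=; rewrite ten_ip fock_in_ip lact_adj /= lactM //.
- by move=> T; split=> [TE [a k]|TE a k]; [exact: TE|exact: (TE (a, k))].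
Qed.

Lemma vacuum_mor : mor (vacuum M E K).
Proof.
have [iv vE] := vacuum_spec; split=> //.
apply: (intertwines_total K_total iv) => b [a k].
change (vacuum M E K (lact b (lact a k)) = lact b (vacuum M E K (lact a k))).
by rewrite -lactM !vE ten_lact fock_in_lact.
Qed.

End FockSpace.

Section WoldDecomposition.
Variables (R : realType) (M : models R) (A : cstar R).
Variables (E : corr A A) (H : rep A) (V : E -> H -> H).
Hypothesis V_iso : isometric_rep V.
Hypothesis V_lact : forall b xi h, V (lact b xi) h = lact b (V xi h).
Hypothesis H_total : lact_total H.

Let W : rep A := wandering M V.
Let W_ci : closed_invariant (wset M V) := wset_ci M V_iso V_lact.
Let in_mor : mor (@sub_in _ _ _ H (wset M V)) := sub_in_mor (wset M V).
Let iter_mor n := tilde_iter_mor M V_iso V_lact n.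
Let W_total : lact_total W := lact_total_sub W_ci H_total.

(** Isometry strips one [V] from each side, the coefficient [ip xi xi'] being absorbed into [y'].
    When the left degree reaches 0, a vector of [W] faces a value of [V~]. *)
Lemma tilde_iter_orth n m (x : tprod M (tpower M E n) W) (y : tprod M (tpower M E m) H) :
  (n < m)%N -> ip (tilde_iter V (tmap (M := M) id (@sub_in _ _ _ H (wset M V)) x))
                  (tilde_iter V y) = 0.
Proof.
elim: n m x y => [|n IH] [//|m] x y nm.
  move: x; apply: (total_ind (@ten_total _ M _ _ (regular A) W)).
    apply: closed_sub_preim (closed_sub_perpl _).
    exact: isom_bounded (isom_comp (iter_mor 0).1 (tmap_id_mor M _ in_mor).1).
  move=> [a w]; rewrite (tmap_idE M in_mor) tilde_iter0E // -in_mor.2.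
  by apply: ip_sym0; apply: (sub_in_mem W_ci); exists (tmap id (tilde_iter V (n := m)) (tassoc y)).
move: x; apply: (total_ind (@ten_total_ll _ M _ _ _ E (tpower M E n) W)).
  apply: closed_sub_preim (closed_sub_perpl _).
  exact: isom_bounded (isom_comp (iter_mor n.+1).1 (tmap_id_mor M _ in_mor).1).
move=> [[xi eta] w]; rewrite (tmap_idE M in_mor) tilde_iterSE //=.
move: (tassoc y); apply: (total_ind (@ten_total _ M _ _ E (tprod M (tpower M E m) H))).
  apply: closed_sub_preim (closed_sub_perp _).
  exact: isom_bounded (isom_comp (tilde_mor M V_iso V_lact).1 (tmap_id_mor M _ (iter_mor m)).1).
move=> [xi' y']; rewrite (tmap_idE M (iter_mor m)) tildeE // V_iso.
by rewrite -(iter_mor m).2 -(tmap_idE M in_mor) IH.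
Qed.

Definition wold_family (p : homogeneous M E * W) : H :=
  tilde_iter V (ten M (projT2 p.1) (sub_in p.2)).

Hypothesis V_pure : pure_rep M V.

(* A vector orthogonal to all the V~_n(E^n (x) W) lies in the range of every
   V~_n: peel off one V~, and note that the orthogonal complement N of the family
   satisfies z in E (x) N whenever V~z is in N.  Purity then kills it. *)
Lemma wold_total : total_family wold_family.
Proof.
pose N : set H := ominus (range wold_family).
have N_ci : closed_invariant N.
  apply: closed_invariant_ominus => a _ [[[n eta] w] _ <-].
  exists (existT _ n (lact a eta), w) => //.
  by rewrite /wold_family /= -ten_lact (iter_mor n).2.
have NE h p : N h -> ip (wold_family p) h = 0 by apply; exists p.
have in_range n h : N h -> exists y, tilde_iter (M := M) V (n := n) y = h.
  elim: n h => [|n IH] h hN.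
    move: {hN} h; apply: (total_ind H_total); first exact: closed_sub_range (iter_mor 0).1.
    by move=> [a h]; exists (ten M (a : regular A) h); rewrite tilde_iter0E.
  have [z [q [qW hE]]] := wset_decomp M V_iso V_lact h.
  (* [q] lies in [W], and [lact a w] is [V~_0 (a (x) w)], a member of the family to which [h] is
     orthogonal. *)
  have qh : ip q h = 0.
    have [w <-] := sub_in_surj qW; move: w; apply: (total_ind W_total).
      exact: closed_sub_preim (isom_bounded in_mor.1) (closed_sub_perpl _).
    move=> [a w]; rewrite in_mor.2 -(tilde_iter0E M V).
    exact: (NE _ (existT _ 0 (a : regular A), w) hN).
  have q0 : q = 0.
    apply: ip_eq0; move: qh; rewrite hE ipDr (ip_sym0 _) ?add0r //.
    by apply: qW; exists z.
  rewrite q0 addr0 in hE.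
  have [||||u zE] := @tmap_id_range _ M _ _ E (sub N) H (@sub_in _ _ _ H N) (ominus N) _ _ _ z.
  - exact: sub_in_mor.
  - by move=> y t tN; apply: ip_sym0; apply: tN; exact: sub_in_mem.
  - exact: sub_decomp.
  (* Pairing [xi (x) t] with [z] amounts to pairing [V xi t] with [h]. A [t] orthogonal to [N] is in
     the double complement of the family, and [V xi] maps the family into itself, one degree
     higher. *)
  - move=> xi t tN; rewrite -(tilde_mor M V_iso V_lact).1 -hE tildeE //.
    apply: (perp_perp_ind (f := wold_family)
      (Q := fun t => ip (V xi t) h = 0)) => [|[[n' eta] w]|h' h'f].
    + exact: closed_sub_preim (rep_bounded M V_iso xi) (closed_sub_perpl _).
    + have := NE _ (existT _ n'.+1 (ten M xi eta), w) hN.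
      by rewrite /wold_family tilde_iterSE.
    + by apply: tN => _ [p _ <-].
  have [v vE] : exists v : tprod M E (tprod M (tpower M E n) H),
      tmap (M := M) (@id E) (tilde_iter V (n := n)) v = z.
    rewrite zE; move: (u); apply: (total_ind (@ten_total _ M _ _ E (sub N))).
      apply: closed_sub_preim (closed_sub_range (tmap_id_mor M _ (iter_mor n)).1).
      exact: isom_bounded (tmap_id_mor M _ (sub_in_mor N)).1.
    move=> [xi k]; have [y yE] := IH _ (sub_in_mem N_ci k).
    by exists (ten M xi y); rewrite (tmap_idE M (iter_mor n)) (tmap_idE M (sub_in_mor N)) yE.
  by exists (tassocV v); rewrite /= tassocVK vE.
move=> h hN; have {}hN : N h by move=> _ [p _ <-]; exact: hN.
apply: hnrm_eq0; apply/le_anti; rewrite hnrm_ge0 andbT.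
apply: (@le0_small _ _ 1) => e e0.
have /cvgrPdist_lt/(_ e e0)[n _ /(_ n (leqnn _))] := V_pure h.
have [y <-] := in_range n h hN.
(* On the range of [V~_n] the operator [V~_n V~_n^*] is the identity, so purity bounds the norm of
   [h] itself by [e]. *)
rewrite (adj_isomK (iter_mor n).1) mul1r /= sub0r normrN ger0_norm ?hnrm_ge0 //.
exact: ltW.
Qed.

(** The two families have equal inner products: distinct degrees are orthogonal on both sides, and
    equal degrees agree by isometry. The extension is onto because its closed range contains a total
    family. *)
Lemma wold_spec : unitary_op (wold M V) /\
  forall n (eta : tpower M E n) (w : W),
    wold M V (tilde_iter V (ten M eta (sub_in w))) = ten M (fock_in eta) w.
Proof.
have [|T [iT TE]] := isom_ext
  (g := fun p : homogeneous M E * W => ten M (fock_in (projT2 p.1)) p.2) wold_total.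
  have orth n m (eta : tpower M E n) (eta' : tpower M E m) (w w' : W) : (n < m)%N ->
      ip (tilde_iter V (ten M eta (sub_in w))) (tilde_iter V (ten M eta' (sub_in w'))) = 0.
    by move=> nm; rewrite -(tmap_idE M in_mor) tilde_iter_orth.
  move=> [[n eta] w] [[m eta'] w']; rewrite /wold_family /= ten_ip.
  have [nm|nm|nm] := ltngtP n m.
  - by rewrite orth // fock_in_orth ?lact0l ?ip0r // => nE; rewrite nE ltnn in nm.
  - rewrite (ip_sym0 (orth _ _ _ _ _ _ nm)) fock_in_orth ?lact0l ?ip0r //.
    by move=> nE; rewrite nE ltnn in nm.
  - subst m; rewrite fock_in_ip (iter_mor n).1 ten_ip -in_mor.2.
    by rewrite in_mor.1.
have bT := isom_bounded iT.
have TE' n (eta : tpower M E n) w :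
    T (tilde_iter V (ten M eta (sub_in w))) = ten M (fock_in eta) w.
  exact: (TE (existT _ n eta, w)).
have [|//] := @the_opP _ _ _ H (tprod M (fock M E) W) (fun P => unitary_op P /\
    forall n (eta : tpower M E n) (w : wandering M V),
      P (tilde_iter V (ten M eta (sub_in w))) = ten M (fock_in eta) w).
exists T; split=> //; split=> //; split=> //.
apply: (total_ind (@fock_total _ M _ E W)); first exact: closed_sub_range.
by move=> p; exists (wold_family p).
Qed.

Let wold_isom : isom (wold M V) := wold_spec.1.1.2.

(** Both sides send [lact a w] to [a (x) w] in degree 0, since [lact a w] is [V~_0 (a (x) w)]. *)
Lemma wold_wandering w : wold M V (sub_in w) = vacuum M E W w.
Proof.
have [iv vE] := vacuum_spec M E W_total.
move: w; apply: (total_eq W_total _ (isom_bounded iv)).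
  exact: isom_bounded (isom_comp wold_isom in_mor.1).
move=> [a w]; rewrite vE -wold_spec.2 tilde_iter0E //.
Qed.

Lemma wold_creation xi w :
  wold M V (V xi (sub_in w)) = creation M E W xi (vacuum M E W w).
Proof.
have [iv vE] := vacuum_spec M E W_total.
have [S [iS SE]] := creation_ex M E W.
rewrite SE; move: w.
have -> : V xi = fun h => tilde M V (ten M xi h).
  by apply/funext => h; rewrite tildeE.
apply: (total_eq (S := fun w => wold M V (tilde M V (ten M xi (sub_in w))))
  (T := fun w => S (ten M xi (vacuum M E W w))) W_total).
- apply: (bounded_op_comp (isom_bounded wold_isom)).
  apply: (bounded_op_comp (isom_bounded (tilde_mor M V_iso V_lact).1)).
  exact: bounded_op_comp (ten_bounded _ _ _) (isom_bounded in_mor.1).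
- apply: (bounded_op_comp (isom_bounded iS)).
  exact: bounded_op_comp (ten_bounded _ _ _) (isom_bounded iv).
move=> [a w]; rewrite vE -SE creationE -wold_spec.2 tilde_iterSE // tildeE //.
by rewrite tilde_iter0E.
Qed.

Lemma Theta_tilde_spec (E' : corr A A) (U : E' -> H -> H) : isometric_rep U ->
  forall z, Theta_tilde M V U z =
    wold M V (tilde M U (tmap (M := M) (@id E') (@sub_in _ _ _ H (wset M V)) z)).
Proof.
move=> iU; have [it tE] := tilde_spec M iU.
have ThetaE xi (w : W) : @Theta _ M _ _ _ _ V U xi w = wold M V (U xi (sub_in w)).
  by rewrite /Theta /bcl -wold_wandering adj_isomK.
have [|iTh ThE] := @textend_isom _ M _ _ E' W _ (@Theta _ M _ _ _ _ V U).
  by move=> x y x' y'; rewrite !ThetaE wold_isom iU -in_mor.2 in_mor.1.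
apply: (total_eq (@ten_total _ M _ _ E' W) (isom_bounded iTh)).
  apply: isom_bounded; apply: isom_comp wold_isom _.
  exact: isom_comp it (tmap_id_mor M _ in_mor).1.
by move=> [x y]; rewrite ThE (tmap_idE M in_mor) tE ThetaE.
Qed.

End WoldDecomposition.

(** * Product systems *)

Section TwoFactors.
Variables (R : realType) (M : models R) (A : cstar R).
Variables (E1 E2 E : corr A A) (H : rep A).
Variables (V1 : E1 -> H -> H) (V2 : E2 -> H -> H) (V : E -> H -> H).
Variable theta : tprod M E1 E2 -> E.
Hypotheses (V1_iso : isometric_rep V1) (V2_iso : isometric_rep V2).
Hypothesis V_iso : isometric_rep V.
Hypothesis V1_lact : forall b xi h, V1 (lact b xi) h = lact b (V1 xi h).
Hypothesis V2_lact : forall b xi h, V2 (lact b xi) h = lact b (V2 xi h).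
Hypothesis V_lact : forall b xi h, V (lact b xi) h = lact b (V xi h).
Hypotheses (theta_isom : isom theta) (theta_surj : forall e, exists f, theta f = e).
Hypothesis V_theta : forall xi eta h, V (theta (ten M xi eta)) h = V1 xi (V2 eta h).

Let w := wset M V.
Let w1 := wset M V1.
Let w2 := wset M V2.
Let x1 := tilde_image M V1 w2.
Let T1_mor := tilde_mor M V1_iso V1_lact.
Let T2_mor := tilde_mor M V2_iso V2_lact.
Let w_ci : closed_invariant w := wset_ci M V_iso V_lact.
Let w1_ci : closed_invariant w1 := wset_ci M V1_iso V1_lact.
Let w2_ci : closed_invariant w2 := wset_ci M V2_iso V2_lact.

(** Describes [W] by the two factors alone, as the complement of the range of [V1~ (I (x) V2~)]; the
    converse uses that [theta] is onto. *)
Lemma wset_factor h : w h <-> forall u : tprod M E1 (tprod M E2 H),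
  ip (tilde M V1 (tmap (M := M) (@id E1) (tilde M V2) u)) h = 0.
Proof.
have T12 := mor_comp T1_mor (tmap_id_mor M E1 T2_mor).
split=> [wh|uh].
  apply: (total_ind (@ten_total_rr _ M _ _ _ E1 E2 H)).
    exact: closed_sub_preim (isom_bounded T12.1) (closed_sub_perpl _).
  move=> [xi [eta k]]; rewrite (tmap_idE M T2_mor) !tildeE // -V_theta -(tildeE M V_iso).
  by apply: wh; exists (ten M (theta (ten M xi eta)) k).
move=> _ [z _ <-]; move: z.
have T_mor := tilde_mor M V_iso V_lact.
apply: (total_ind (@ten_total _ M _ _ E H)).
  exact: closed_sub_preim (isom_bounded T_mor.1) (closed_sub_perpl _).
move=> [e k]; have [f <-] := theta_surj e.
have th_mor : isom (tmap (M := M) theta (@id H)) by exact: tmap_isom.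
have -> : ten M (theta f) k = tmap (M := M) theta (@id H) (ten M f k).
  by rewrite (tmapE M theta_isom (@mor_id _ _ H)).
move: (ten M f k); apply: (total_ind (@ten_total_ll _ M _ _ _ E1 E2 H)).
  apply: closed_sub_preim (closed_sub_perpl _).
  exact: isom_bounded (isom_comp T_mor.1 th_mor).
move=> [[xi eta] l]; rewrite (tmapE M theta_isom (@mor_id _ _ H)) (tildeE M V_iso) V_theta.
by have := uh (ten M xi (ten M eta l)); rewrite (tmap_idE M T2_mor) !tildeE.
Qed.

Lemma tilde_image_mor :
  mor (fun x : tprod M E1 (sub w2) => tilde M V1 (tmap (M := M) id (@sub_in _ _ _ H w2) x)).
Proof. exact: mor_comp T1_mor (tmap_id_mor M E1 (sub_in_mor w2)). Qed.

Lemma tilde_image_ci : closed_invariant x1.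
Proof. exact: closed_invariant_range tilde_image_mor. Qed.

Lemma wset_sub : w1 `<=` w.
Proof.
move=> h w1h; apply/wset_factor => u; apply: w1h.
by exists (tmap (M := M) (@id E1) (tilde M V2) u).
Qed.

(** After cancelling the isometry [V1~], this is the orthogonality of [E1 (x) W_2] and
    [E1 (x) V2~(E2 (x) H)]. *)
Lemma tilde_image_sub : x1 `<=` w.
Proof.
move=> _ [z _ <-]; apply/wset_factor => u; rewrite T1_mor.1.
move: u; apply: (total_ind (@ten_total _ M _ _ E1 (tprod M E2 H))).
  exact: closed_sub_preim (isom_bounded (tmap_id_mor M E1 T2_mor).1) (closed_sub_perpl _).
move=> [xi y]; rewrite (tmap_idE M T2_mor).
move: z; apply: (total_ind (@ten_total _ M _ _ E1 (sub w2))).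
  exact: closed_sub_preim (isom_bounded (tmap_id_mor M E1 (sub_in_mor w2)).1) (closed_sub_perp _).
move=> [eta k]; rewrite (tmap_idE M (sub_in_mor w2)) ten_ip -(sub_in_mor w2).2.
by apply: (sub_in_mem w2_ci); exists y.
Qed.

(** Write [h = V1~ z + q] with [q] in [W_1]. As [h] and [q] are both orthogonal to the range of
    [V1~ (I (x) V2~)], [z] is orthogonal to [E1 (x) V2~(E2 (x) H)] and so lies in [E1 (x) W_2]. *)
Lemma wset_split h : w h -> exists (x : sub x1) (y : sub w1), h = sub_in x + sub_in y.
Proof.
move=> wh; have [z [q [qw1 hE]]] := wset_decomp M V1_iso V1_lact h.
have [y yE] := sub_in_surj qw1.
have [||||u zE] := @tmap_id_range _ M _ _ E1 (sub w2) H (@sub_in _ _ _ H w2)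
    (range (tilde M V2)) _ _ _ z.
- exact: sub_in_mor.
- by move=> k _ [v _ <-]; apply: (sub_in_mem w2_ci); exists v.
- move=> k; have [v [l [w2l ->]]] := wset_decomp M V2_iso V2_lact k.
  have [l' <-] := sub_in_surj w2l; exists l', (tilde M V2 v).
  by split; [exists v|rewrite addrC].
- move=> xi _ [v _ <-]; rewrite -T1_mor.1 -(tmap_idE M T2_mor).
  have /wset_factor/(_ (ten M xi v)) := wh.
  by rewrite {1}hE ipDr (qw1 (tilde M V1 _)) ?addr0 //; eexists.
have [|x xE] := @sub_in_surj _ _ _ x1 (tilde M V1 z).
  by exists u; rewrite // zE.
by exists x, y; rewrite xE yE.
Qed.

(** [F] is left free because this splitting of [W], which starts from [V1~], is tensored in the
    theorem with the other factor of the product system. *)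
Lemma incl_orth_decomp (F : corr A A) :
  orth_decomp (tmap (M := M) (@id F) (incl x1 w)) (tmap (M := M) (@id F) (incl w1 w)).
Proof.
have [im iE] := incl_spec tilde_image_ci w_ci tilde_image_sub.
have [jm jE] := incl_spec w1_ci w_ci wset_sub.
have iw := sub_in_mor w.
apply: tmap_orth_decomp => // [x y|z].
  rewrite -iw.1 iE jE; have [v _ <-] := sub_in_mem tilde_image_ci x.
  by apply: (sub_in_mem w1_ci); eexists.
have [x [y zE]] := wset_split (sub_in_mem w_ci z).
by exists x, y; apply: (isom_inj iw.1); rewrite zE (linD (isom_linear iw.1)) iE jE.
Qed.

(** Makes [tilde_adj_restr] the inverse of the isometry of [tilde_image_mor], so that its own
    properties follow by cancelling that isometry. *)
Lemma tilde_adj_restrE k :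
  tilde M V1 (tmap (M := M) id (@sub_in _ _ _ H w2) (tilde_adj_restr M V1 w2 k)) = sub_in k.
Proof.
have [u _ kE] := sub_in_mem tilde_image_ci k.
rewrite /tilde_adj_restr -kE (adj_isomK T1_mor.1) pullK //.
exact: (tmap_id_mor M E1 (sub_in_mor w2)).1.
Qed.

Lemma tilde_adj_restr_mor : mor (@tilde_adj_restr _ M _ _ _ V1 w2).
Proof.
split=> [x y|a x].
  by rewrite -tilde_image_mor.1 !tilde_adj_restrE (sub_in_mor x1).1.
apply: (mor_inj tilde_image_mor).
by rewrite tilde_image_mor.2 !tilde_adj_restrE (sub_in_mor x1).2.
Qed.

End TwoFactors.

(** * The formula for one factor, symmetric in the two orders *)

Section BCLFormula.
Variables (R : realType) (M : models R) (A : cstar R).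
Variables (E1 E2 E : corr A A) (H : rep A).
Variables (V1 : E1 -> H -> H) (V2 : E2 -> H -> H) (V : E -> H -> H).
Variables (theta : tprod M E1 E2 -> E) (theta' : tprod M E2 E1 -> E).
Hypotheses (V1_iso : isometric_rep V1) (V2_iso : isometric_rep V2).
Hypothesis V_iso : isometric_rep V.
Hypothesis V1_lact : forall b xi h, V1 (lact b xi) h = lact b (V1 xi h).
Hypothesis V2_lact : forall b xi h, V2 (lact b xi) h = lact b (V2 xi h).
Hypothesis V_lact : forall b xi h, V (lact b xi) h = lact b (V xi h).
Hypotheses (theta_isom : isom theta) (theta_surj : forall e, exists f, theta f = e).
Hypotheses (theta'_isom : isom theta') (theta'_surj : forall e, exists f, theta' f = e).
Hypothesis V_theta : forall xi eta h, V (theta (ten M xi eta)) h = V1 xi (V2 eta h).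
Hypothesis V_theta' : forall eta xi h, V (theta' (ten M eta xi)) h = V2 eta (V1 xi h).
Hypothesis H_total : lact_total H.
Hypothesis V_pure : pure_rep M V.

Let w := wset M V.
Let w1 := wset M V1.
Let w2 := wset M V2.
Let x2 := tilde_image M V2 w1.
Let W := wandering M V.
Let w_ci : closed_invariant w := wset_ci M V_iso V_lact.
Let w1_ci : closed_invariant w1 := wset_ci M V1_iso V1_lact.
Let w2_ci : closed_invariant w2 := wset_ci M V2_iso V2_lact.
Let T1_mor := tilde_mor M V1_iso V1_lact.
Let T2_mor := tilde_mor M V2_iso V2_lact.
Let c := tmap (M := M) (@id E) (vacuum M E W).
Let S_tilde := tilde M (creation M E W).

Lemma wold_theta (z : tprod M E1 (tprod M E2 W)) :
  wold M V (tilde M V1 (tmap (M := M) (@id E1)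
    (fun u => tilde M V2 (tmap (M := M) (@id E2) (@sub_in _ _ _ H w) u)) z)) =
  S_tilde (c (tmap (M := M) theta (@id W) (tassocV z))).
Proof.
have W_total : lact_total W := lact_total_sub w_ci H_total.
have v_mor := vacuum_mor M E W_total.
have T2in_mor := mor_comp T2_mor (tmap_id_mor M E2 (sub_in_mor w)).
have [S_isom SE] := tilde_spec M (creation_isometric (M := M) (E := E) (K := W)).
have wold_isom : isom (wold M V) := (wold_spec V_iso V_lact H_total V_pure).1.1.2.
have th_isom : isom (tmap (M := M) theta (@id W)) by exact: tmap_isom.
move: z; apply: (total_eq (@ten_total_rr _ M _ _ _ E1 E2 W)).
- apply: isom_bounded; apply: (isom_comp wold_isom).
  exact: isom_comp T1_mor.1 (tmap_id_mor M E1 T2in_mor).1.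
- apply: isom_bounded; apply: (isom_comp S_isom).
  apply: (isom_comp (tmap_id_mor M E v_mor).1).
  apply: (isom_comp th_isom).
  exact: tassocV_isom.
move=> [xi [eta k]]; rewrite tassocVE (tmap_idE M T2in_mor) (tmap_idE M (sub_in_mor w)).
rewrite /S_tilde /c !tildeE // (tmapE M theta_isom (@mor_id _ _ W)) (tmap_idE M v_mor) SE.
by rewrite -V_theta wold_creation.
Qed.

(** Both orders occur at once: [theta'] places the summands [V2~(E2 (x) W_1)] and [W_2] inside [W],
    while [theta] does so for [W_1] and for the values of [V1~] on [E1 (x) W_2]. *)
Lemma Theta_tilde_summands
    (x : tprod M E1 (sub x2)) (y : tprod M E1 (sub w2)) :
  Theta_tilde M V V1 (tmap (M := M) id (incl x2 w) x + tmap (M := M) id (incl w2 w) y) =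
  S_tilde (c (tmap (M := M) theta (@id W) (tassocV
    (tmap (M := M) (@id E1) (tmap (M := M) (@id E2) (incl w1 w))
      (tmap (M := M) (@id E1) (@tilde_adj_restr _ M _ _ _ V2 w1) x)))))
  + vacuum M E W (tilde_restr M V1 w2 w y).
Proof.
have wold_isom : isom (wold M V) := (wold_spec V_iso V_lact H_total V_pure).1.1.2.
have [i1_mor i1E] := incl_spec
  (tilde_image_ci M V1 V2_iso V2_lact) w_ci
  (tilde_image_sub V2_iso V1_iso V_iso V2_lact V1_lact V_lact theta'_isom theta'_surj V_theta').
have [i2_mor i2E] := incl_spec w2_ci w_ci
  (wset_sub V2_iso V1_iso V_iso V2_lact V1_lact V_lact theta'_isom theta'_surj V_theta').
have [i3_mor i3E] := incl_spec w1_ci w_ci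
  (wset_sub V1_iso V2_iso V_iso V1_lact V2_lact V_lact theta_isom theta_surj V_theta).
have in_mor := sub_in_mor w.
rewrite (Theta_tilde_spec V_iso V_lact H_total V_pure V1_iso).
rewrite (linD (isom_linear (tmap_id_mor M E1 in_mor).1)) (linD (isom_linear T1_mor.1)).
rewrite (linD (isom_linear wold_isom)).
rewrite (tmap_id_comp in_mor i1_mor (fun k => esym (i1E k))).
rewrite (tmap_id_comp in_mor i2_mor (fun k => esym (i2E k))).
congr (_ + _); last first.
  rewrite -(wold_wandering V_iso V_lact H_total V_pure); congr wold.
  (* [tilde_restr] is a [pull], which falls back to 0 off the range; it has its intended value
     because [V1~] maps [E1 (x) W_2] into [W]. *)
  apply/esym; apply: (pullP (j := @sub_in _ _ _ H w)); apply: (sub_in_surj (P := w)).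
  apply: (tilde_image_sub V1_iso V2_iso V_iso V1_lact V2_lact V_lact theta_isom theta_surj V_theta).
  by exists y.
rewrite -wold_theta; congr (wold M V (tilde M V1 _)).
have T2in_mor := mor_comp T2_mor (tmap_id_mor M E2 in_mor).
have J_mor := mor_comp T2in_mor (tmap_id_mor M E2 i3_mor).
have ar_mor := tilde_adj_restr_mor M V1 V2_iso V2_lact.
rewrite (tmap_id_comp T2in_mor (tmap_id_mor M E2 i3_mor) (fun k => erefl)).
(* On [V2~(E2 (x) W_1)], [V2~] undoes the restricted adjoint, leaving the inclusion into [H]. *)
apply/esym; apply: (tmap_id_comp J_mor ar_mor) => k /=.
rewrite (tmap_id_comp in_mor i3_mor (fun k => esym (i3E k))).
by apply/esym; exact: (tilde_adj_restrE V2_iso V2_lact).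
Qed.

End BCLFormula.

(** * The representation of [E] attached to a product system *)

Section ProductSystemRep.
Variables (R : realType) (M : models R) (A : cstar R).
Variables (P : product_system M A) (H : rep A).
Variables (V1 : ps1 P -> H -> H) (V2 : ps2 P -> H -> H).
Hypothesis V_isometric : ps_isometric V1 V2.

Lemma ps_lact1 b xi h : V1 (lact b xi) h = lact b (V1 xi h).
Proof. by have [[c1 _ _] i1 _] := V_isometric; exact: covrep_lact. Qed.

Lemma ps_lact2 b xi h : V2 (lact b xi) h = lact b (V2 xi h).
Proof. by have [[_ c2 _] _ i2] := V_isometric; exact: covrep_lact. Qed.

Let T1_mor : mor (tilde M V1).
Proof. by have [_ i1 _] := V_isometric; exact: tilde_mor i1 ps_lact1. Qed.

Let T2_mor : mor (tilde M V2).
Proof. by have [_ _ i2] := V_isometric; exact: tilde_mor i2 ps_lact2. Qed.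

Let T12_mor : mor (fun z : tprod M (ps_prod P) H =>
  tilde M V1 (tmap (M := M) (@id (ps1 P)) (tilde M V2) (tassoc z))).
Proof.
exact: mor_comp T1_mor (mor_comp (tmap_id_mor M _ T2_mor) (tassoc_mor M _ _ H)).
Qed.

Lemma ps_rep_isometric : isometric_rep (ps_rep V1 V2).
Proof. by move=> eta xi h k; rewrite /ps_rep T12_mor.1 ten_ip. Qed.

Lemma ps_rep_lact b xi h : ps_rep V1 V2 (lact b xi) h = lact b (ps_rep V1 V2 xi h).
Proof. by rewrite /ps_rep -ten_lact T12_mor.2. Qed.

Lemma ps_rep_ten xi eta h : ps_rep V1 V2 (ten M xi eta) h = V1 xi (V2 eta h).
Proof.
have [_ i1 i2] := V_isometric.
by rewrite /ps_rep tassocE (tmap_idE M T2_mor) !tildeE.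
Qed.

Lemma t12_isom : isom (@t12 _ _ _ P).
Proof. by move=> x y; rewrite -(t21_unitary P).1.2 !t12K. Qed.

(** The commutation relation enters only here: it exchanges the two factors at the price of a [t12],
    which cancels [t21]. *)
Lemma ps_rep_t21 eta xi h : ps_rep V1 V2 (t21 (ten M eta xi)) h = V2 eta (V1 xi h).
Proof.
have [[_ _ comm] i1 i2] := V_isometric.
rewrite /ps_rep comm (tmapE M t12_isom (@mor_id _ _ H)) t21K.
by rewrite tassocE (tmap_idE M T1_mor) !tildeE.
Qed.

End ProductSystemRep.

(** Removes the map [theta (x) I] from the formula when [theta] is the identity, as in the case i =
    1. *)
Lemma tmap_id_id (R : realType) (M : models R) (A B : cstar R) (E : corr A B)
    (F : corr B (complex_cstar R)) z : tmap (M := M) (@id E) (@id F) z = z.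
Proof.
have ii : isom (tmap (M := M) (@id E) (@id F)) by exact: tmap_isom.
move: z; apply: (total_eq (T := id) (@ten_total _ M _ _ E F) (isom_bounded ii)).
  exact: (@isom_bounded _ _ _ _ id).
by move=> [x y]; rewrite (tmap_idE M (@mor_id _ _ F)).
Qed.

Theorem theorem2p4 (R : realType) (M : models R) (A : cstar R)
    (P : product_system M A) (H : rep A)
    (V1 : ps1 P -> H -> H) (V2 : ps2 P -> H -> H)
    (V_isometric : ps_isometric V1 V2)
    (V_pure : pure_rep M (ps_rep V1 V2)) :
  let E1 := ps1 P in
  let E2 := ps2 P in
  let E := ps_prod P in
  let V := ps_rep V1 V2 in
  (* W, W_1, W_2, V1~(E_1 (x) W_2) and V2~(E_2 (x) W_1) as subsets of H *)
  let w := wset M V in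
  let w1 := wset M V1 in
  let w2 := wset M V2 in
  let x1 := tilde_image M V1 w2 in
  let x2 := tilde_image M V2 w1 in
  let W := wandering M V in
  let S_tilde := tilde M (creation M E W) in
  (* E (x) W inside E (x) F(E) (x) W *)
  let c := tmap (M := M) (@id E) (vacuum M E W) in
  (* the summands of E_1 (x) W and of E_2 (x) W *)
  let i1 := tmap (M := M) (@id E1) (incl x2 w) in
  let j1 := tmap (M := M) (@id E1) (incl w2 w) in
  let i2 := tmap (M := M) (@id E2) (incl x1 w) in
  let j2 := tmap (M := M) (@id E2) (incl w1 w) in
  [/\ orth_decomp i1 j1,
      forall x y, Theta_tilde M V V1 (i1 x + j1 y) =
        S_tilde (c (tassocV (tmap id j2 (tmap id (tilde_adj_restr M V2 w1) x))))
        + vacuum M E W (tilde_restr M V1 w2 w y),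
      orth_decomp i2 j2 &
      forall x y, Theta_tilde M V V2 (i2 x + j2 y) =
        S_tilde (c (tmap (@t21 _ _ _ P) id
          (tassocV (tmap id j1 (tmap id (tilde_adj_restr M V1 w2) x)))))
        + vacuum M E W (tilde_restr M V2 w1 w y)].
Proof.
have [[c1 _ _] i1 i2] := V_isometric.
have H_total : lact_total H := nondegenerate_total (cov_nondegenerate c1).
have l1 := ps_lact1 V_isometric; have l2 := ps_lact2 V_isometric.
have iV := ps_rep_isometric V_isometric; have lV := ps_rep_lact V_isometric.
have vE := ps_rep_ten V_isometric; have vE' := ps_rep_t21 V_isometric.
have [[_ t21_isom] t21_surj] := t21_unitary P.
have id_isom : isom (@id (ps_prod P)) by [].
have id_surj (e : ps_prod P) : exists f : tprod M (ps1 P) (ps2 P), id f = e by exists e.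
move=> E1 E2 E V w w1 w2 x1 x2 W S_tilde c i1' j1 i2' j2; split.
- exact: (incl_orth_decomp i2 i1 iV l2 l1 lV t21_isom t21_surj vE' E1).
- move=> x y.
  have := Theta_tilde_summands i1 i2 iV l1 l2 lV id_isom id_surj t21_isom t21_surj
    vE vE' H_total V_pure x y.
  by rewrite tmap_id_id.
- exact: (incl_orth_decomp i1 i2 iV l1 l2 lV id_isom id_surj vE E2).
- move=> x y.
  exact: (Theta_tilde_summands i2 i1 iV l2 l1 lV t21_isom t21_surj id_isom id_surj
    vE' vE H_total V_pure x y).
Qed.
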